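(* For $1\le q\le p<\infty$, $p>1$, $r>1/q$, we have $$ \varrho_m^o(\mathbf H^r_q,L_p)\ \ge\ c(d)\, m^{-r+1/q-1/p}\,(\log m)^{(d-1)/p}, $$ where $c(d)$ is a positive constant.
   Context: Constants: the arguments of a constant indicate the parameters which it may depend on; thus $c(d)>0$ is a constant that may depend on $d$, and it does not depend on the running parameter $m\in\mathbb N$. Functions are $2\pi$-periodic in each of $d$ variables, defined on $\mathbb T^d:=[0,2\pi]^d$, with $\|f\|_p:=\left((2\pi)^{-d}\int_{\mathbb T^d}|f(\mathbf x)|^p d\mathbf x\right)^{1/p}$ for $1\le p<\infty$ and $\|f\|_\infty:=\sup_{\mathbf x\in\mathbb T^d}|f(\mathbf x)|$; $L_p=L_p(\mathbb T^d)$ is taken with respect to the normalized Lebesgue measure. Classes $\mathbf H^r_q$. For $\mathbf t=(t_1,\dots,t_d)$ and $l\in\mathbb N$ let $\Delta^l_{t_j,j}$ be the $l$-th difference operator with step $t_j$ in the variable $x_j$ (the $l$-th power of $f\mapsto f(\dots,x_j+t_j,\dots)-f(\dots,x_j,\dots)$). For a subset $e\subset\{1,\dots,d\}$ let $\Delta^l_{\mathbf t}(e):=\prod_{j\in e}\Delta^l_{t_j,j}$, and let $\Delta^l_{\mathbf t}(\varnothing)$ be the identity operator. For $r>0$ and $1\le q\le\infty$ put $l:=[r]+1$, where $[r]$ is the integer part of $r$. The class $\mathbf H^r_q$ is the set of all $f\in L_q(\mathbb T^d)$ such that for every $e\subset\{1,\dots,d\}$ and every $\mathbf t$ $$\|\Delta^l_{\mathbf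 t}(e)f\|_q\le\prod_{j\in e}|t_j|^r .$$ (For $r>1/q$ these functions are identified with their continuous representatives.) Optimal nonlinear sampling recovery. For a class $W$ of continuous functions on $\mathbb T^d$, $$\varrho_m^o(W,L_p):=\inf_{\xi}\inf_{\mathcal M}\sup_{f\in W}\|f-\mathcal M(f(\xi^1),\dots,f(\xi^m))\|_p,$$ where $\mathcal M$ ranges over all (not necessarily linear) mappings $\mathcal M:\mathbb C^m\to L_p(\mathbb T^d)$ and $\xi$ ranges over all subsets $\{\xi^1,\dots,\xi^m\}$ of $m$ points in $\mathbb T^d$.
   Formalization: The constant is allowed to depend on r as well as on d (it stays uniform in q, p and m); a constant depending on d alone is impossible for large d, as r approaches 1 from below with p=2, 1<q<4/3. *)

(* Defs.v *)
From HB Require Import structures.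
From mathcomp Require Import all_boot all_order all_algebra.
From mathcomp Require Import all_classical all_reals all_analysis.
From mathcomp.real_closed Require Import complex.
Import Order.TTheory GRing.Theory Num.Theory.
Import numFieldNormedType.Exports.

Set Implicit Arguments.
Unset Strict Implicit.
Unset Printing Implicit Defensive.

Local Open Scope classical_set_scope.
Local Open Scope ring_scope.

Section torus_measure.
Context {R : realType}.
Local Notation mR := (measurableTypeR R).

Lemma two_pi_gt0 : 0 < 2 * pi :> R.
Proof. by rewrite mulr_gt0 ?pi_gt0. Qed.

Definition circle_prob : probability mR R := uniform_prob two_pi_gt0.

Definition tuple_cons (n : nat) (z : mR * n.-tuple mR) : n.+1.-tuple mR :=
  [the n.+1.-tuple mR of z.1 :: z.2].

Lemma measurable_tuple_cons (n : nat) :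
  measurable_fun [set: _] (@tuple_cons n).
Proof. exact: measurable_cons. Qed.

HB.instance Definition _ (n : nat) :=
  isMeasurableFun.Build _ _ _ _ (@tuple_cons n) (@measurable_tuple_cons n).

(* The measure (2 pi)^-d dx on [0, 2 pi]^d, as a d-fold product of the uniform
   probability on [0, 2 pi]. *)
Fixpoint torus_prob (d : nat) : probability (d.-tuple mR) R :=
  if d is n.+1 then distribution (circle_prob \x torus_prob n)%E (@tuple_cons n)
  else \d_([tuple] : 0.-tuple mR).

End torus_measure.

Section sampling_recovery.
Context {R : realType} (d : nat).
Local Notation C := R[i].
Local Notation Rd := 'rV[R]_d.
Implicit Types (f g : Rd -> C) (x t : Rd) (p q : \bar R) (r : R).

Definition torus : set Rd := [set x | forall j, x 0 j \in `[0, 2 * pi]].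

Definition periodic f : Prop :=
  forall x (j : 'I_d), f (x + (2 * pi) *: delta_mx 0 j) = f x.

Definition on_tuple (T : Type) (h : Rd -> T) : d.-tuple R -> T :=
  fun u => h (\row_j tnth u j).

(* For p = +oo, Lnorm is the essential supremum, which is the supremum for
   continuous periodic functions. *)
Definition Lp_norm p f : \bar R :=
  Lnorm (torus_prob d) p (fun u => (Normc.normc (on_tuple f u))%:E).

Definition borel_measurable f : Prop :=
  measurable_fun [set: d.-tuple (measurableTypeR R)]
    (on_tuple (fun x => complex.Re (f x)) : _ -> measurableTypeR R) /\
  measurable_fun [set: d.-tuple (measurableTypeR R)]
    (on_tuple (fun x => complex.Im (f x)) : _ -> measurableTypeR R).

(* Representatives, not classes modulo null sets: point values are sampled. *)
Definition Lp p : set (Rd -> C) :=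
  [set f | [/\ periodic f, borel_measurable f & (Lp_norm p f < +oo)%E]].

Definition diff1 t (j : 'I_d) f : Rd -> C :=
  fun x => f (x + t 0 j *: delta_mx 0 j) - f x.

Definition mixed_diff (l : nat) t (e : {set 'I_d}) : (Rd -> C) -> Rd -> C :=
  \big[comp/id]_(j in e) iter l (diff1 t j).

(* For r > 1/q every class of L_q satisfying the difference inequalities has
   exactly one continuous representative, which is the one kept here. *)
Definition Hclass r q : set (Rd -> C) :=
  [set f | [/\ Lp q f, continuous (f : Rd -> C^o) &
     forall (e : {set 'I_d}) t,
       (Lp_norm q (mixed_diff (Num.truncn r).+1 t e f)
          <= (\prod_(j in e) (`|t 0 j| `^ r))%:E)%E]].

Definition sample (m : nat) (xi : 'I_m -> Rd) f : 'rV[C]_m :=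
  \row_i f (xi i).

Definition worst_error (W : set (Rd -> C)) p (m : nat)
    (xi : 'I_m -> Rd) (M : 'rV[C]_m -> Rd -> C) : \bar R :=
  ereal_sup [set Lp_norm p (fun x => f x - M (sample xi f) x) | f in W].

Definition opt_recovery (W : set (Rd -> C)) p (m : nat) : \bar R :=
  ereal_inf [set
      ereal_inf [set worst_error W p xi M | M in [set M | forall y, Lp p (M y)]]
    | xi in [set xi : 'I_m -> Rd | injective xi /\ forall i, torus (xi i)]].

End sampling_recovery.

(* Main.v *)
Require Import Defs.
From mathcomp Require Import all_boot all_order all_algebra.
From mathcomp Require Import all_classical all_reals all_analysis measurable_realfun.
From mathcomp.real_closed Require Import complex.
From mathcomp Require Import ring lra.
Import Order.TTheory GRing.Theory Num.Theory.
Import numFieldNormedType.Exports.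
Local Open Scope ring_scope.
Local Open Scope classical_set_scope.

(** The bound is proved by fooling: for every choice of [m] sample points there
    is a function [f] of the class that vanishes at all of them and has a large
    L_p norm. Both [f] and [- f] then produce the sample 0, so whatever function
    is reconstructed from it is at distance at least the norm of [f] from one of
    them (lemma [opt_recovery_ge]).

    Let [n] be least with [m < 2 ^ n]. For each vector [s] of nonnegative
    integers with sum [n], the torus is cut into [2 ^ n] boxes with sides
    [2 pi / 2 ^ s_j]. There are more boxes than sample points, so one of them is
    free, and it carries a bump of height 1 that vanishes at all the sample
    points ([exists_free_cell]). The bump is a product of bumps in one variable
    and smooth enough for differences of the order [l] used by the class. The
    function [f] is the sum of these bumps, one for each [s], times an amplitude
    of order [2 ^ (- n (r - 1/q))].

    The sum has about [n ^ (d - 1)] terms, and yet [f] belongs to the class with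
    an amplitude that ignores their number. A difference of order [l > r] with
    step [t] of a bump of width [2 ^ (- i)] is bounded by a multiple of
    [min (1, (2 ^ i t) ^ l)], and the product of this bound with [2 ^ (- r i)]
    sums over all [i] to at most a constant times [t ^ r] ([dyadic_min_sum_le]).
    As [2 ^ (- n r)] is the product of the [2 ^ (- r s_j)], the sum over [s] is
    dominated by a product of such sums, one per variable
    ([Lp_norm_mixed_diff_level_bumps_le]).

    The L_p norm does see the number of terms. The bumps are nonnegative and
    each is bounded below on a box of volume of order [2 ^ (- n)], so the [p]-th
    powers of their norms add up ([Lp_norm_level_bumps_ge]). Up to constants this
    gives [2 ^ (- n (r - 1/q)) (n ^ (d - 1) 2 ^ (- n)) ^ (1/p)], which is the
    claim, as [2 ^ n] is comparable to [m] and [n] dominates [ln m]. *)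

(** * Differences of functions with bounded derivatives *)

Definition fdiff {R : realType} (t : R) (f : R -> R) : R -> R :=
  fun x => f (x + t) - f x.

Fixpoint deriv_bounded {R : realType} (k : nat) (M : R) (f : R -> R) : Prop :=
  if k is k'.+1 then
    exists2 f' : R -> R, (forall x : R, is_derive x 1 f (f' x)) & deriv_bounded k' M f'
  else forall x, `|f x| <= M.

Lemma mean_value {R : realType} (f f' : R -> R) (x y : R) :
  (forall z : R, is_derive z 1 f (f' z)) -> exists z, f y - f x = f' z * (y - x).
Proof.
move=> df.
have cf a b : {within `[a, b], continuous f}.
  by apply: derivable_within_continuous => z _; exact: ex_derive.
have [xy|yx|->] := ltgtP x y; last by exists y; rewrite !subrr mulr0.
- by have [z _ ->] := MVT xy (fun z _ => df z) (@cf _ _); exists z.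
- have [z _ e] := MVT yx (fun z _ => df z) (@cf _ _); exists z.
  by rewrite -opprB e -mulrN opprB.
Qed.

Lemma is_derive_translate {R : realType} (f : R -> R) (t x d : R) :
  is_derive (x + t) 1 f d -> is_derive x 1 (fun y => f (y + t)) d.
Proof.
move=> df; rewrite -[d]mulr1.
apply: (@is_derive1_comp _ f (fun y => y + t)).
exact: is_derive_shift.
Qed.

Lemma is_derive_iter_fdiff {R : realType} (f f' : R -> R) (t : R) (k : nat) :
  (forall x : R, is_derive x 1 f (f' x)) ->
  forall x : R, is_derive x 1 (iter k (fdiff t) f) (iter k (fdiff t) f' x).
Proof.
move=> df; elim: k => [//|k IH] x /=; rewrite {2}/fdiff.
by apply: is_deriveB; apply: is_derive_translate.
Qed.

(** By the mean value theorem each difference costs a factor [t] and one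
    derivative. *)
Lemma iter_fdiff_le {R : realType} (t M : R) (k : nat) (f : R -> R) (x : R) :
  deriv_bounded k M f -> `|iter k (fdiff t) f x| <= `|t| ^+ k * M.
Proof.
elim: k f x => [|k IH] f x /=; first by rewrite expr0 mul1r.
case=> f' df bf'; rewrite {1}/fdiff.
have [z ->] := mean_value _ _ x (x + t) (is_derive_iter_fdiff _ _ t k df).
rewrite [x + t]addrC addrK normrM mulrC exprS -mulrA.
by rewrite ler_wpM2l// IH.
Qed.

Lemma iter_fdiff_le_sup {R : realType} (t M : R) (k : nat) (f : R -> R) (x : R) :
  (forall y, `|f y| <= M) -> `|iter k (fdiff t) f x| <= 2 ^+ k * M.
Proof.
move=> fM; elim: k x => [|k IH] x /=; first by rewrite expr0 mul1r.
rewrite {1}/fdiff (le_trans (ler_normB _ _))//.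
by rewrite exprS -mulrA [2 * _]mulr_natl mulr2n lerD.
Qed.

Lemma iter_fdiff_eq0 {R : realType} (t : R) (k : nat) (f : R -> R) (x : R) :
  (forall i, (i <= k)%N -> f (x + i%:R * t) = 0) -> iter k (fdiff t) f x = 0.
Proof.
elim: k x => [|k IH] x f0 /=; first by rewrite -(f0 0%N)// mul0r addr0.
rewrite {1}/fdiff IH => [|i ik].
  by rewrite IH ?subrr// => i ik; apply: f0; exact: leqW.
by rewrite -addrA -{1}[t]mul1r -mulrDl -[1 + _]mulrS f0.
Qed.

Lemma deriv_bounded_le {R : realType} (k : nat) (M M' : R) (f : R -> R) :
  M <= M' -> deriv_bounded k M f -> deriv_bounded k M' f.
Proof.
move=> MM'; elim: k f => [|k IH] f /=; first by move=> fM x; exact: le_trans MM'.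
by case=> f' df /IH; exists f'.
Qed.

Lemma deriv_boundedD {R : realType} (k : nat) (M M' : R) (f g : R -> R) :
  deriv_bounded k M f -> deriv_bounded k M' g ->
  deriv_bounded k (M + M') (fun x => f x + g x).
Proof.
elim: k f g => [|k IH] f g /=.
  by move=> fM gM x; rewrite (le_trans (ler_normD _ _))// lerD.
case=> f' df bf [g' dg bg]; exists (fun x => f' x + g' x); last exact: IH.
by move=> x; exact: is_deriveD.
Qed.

Lemma deriv_boundedZ {R : realType} (k : nat) (M c : R) (f : R -> R) :
  deriv_bounded k M f -> deriv_bounded k (`|c| * M) (fun x => c * f x).
Proof.
elim: k f => [|k IH] f /=; first by move=> fM x; rewrite normrM ler_wpM2l.
case=> f' df bf; exists (fun x => c * f' x); last exact: IH.
by move=> x; exact: is_deriveZ.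
Qed.

(** * The periodic bump *)

Lemma continuous_max0 {R : realType} : continuous (fun y : R => Num.max 0 y).
Proof.
move=> y.
have -> : (fun z : R => Num.max 0 z) = (fun z => (z + `|z|) / 2).
  by apply/funext => z; rewrite maxr_absE add0r sub0r normrN.
by apply: cvgMl; apply: cvgD; [exact: cvg_id|apply: cvg_norm; exact: cvg_id].
Qed.

Lemma continuous_max0X {R : realType} (n : nat) :
  continuous (fun y : R => Num.max 0 y ^+ n).
Proof.
move=> y; apply: (@cvg_comp _ _ _ (fun y : R => Num.max 0 y) (fun y => y ^+ n)).
  exact: continuous_max0.
exact: exprn_continuous.
Qed.

Lemma is_derive_max0X {R : realType} (n : nat) (x : R) :
  is_derive x 1 (fun y => Num.max 0 y ^+ n.+2) (n.+2%:R * Num.max 0 x ^+ n.+1).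
Proof.
have [x0|x0|->] := ltgtP x 0.
- rewrite expr0n/= mulr0.
  apply: (@near_eq_is_derive _ _ _ (cst 0)).
  near=> y; rewrite /= max_l ?expr0n//.
  by near: y; apply: filterS (lt_nbhsl x0) => ? /ltW.
- apply: (@near_eq_is_derive _ _ _ ((@id R) ^+ n.+2)).
    near=> y; rewrite /= max_r; last by near: y; apply: filterS (lt_nbhsr x0) => ? /ltW.
    by rewrite fctE.
  by apply: is_derive_eq; rewrite scaler1.
  (* At the corner, max 0 y ^ (n + 2) = max 0 y ^ (n + 1) * y exhibits a
     continuous difference quotient. *)
- apply/is_derive1_caratheodory; exists (fun y => Num.max 0 y ^+ n.+1).
  split.
  + move=> y; rewrite maxxx expr0n/= !subr0.
    have [y0|y0] := leP 0 y; rewrite exprSr//.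
    by rewrite expr0n/= !mul0r.
  + exact: continuous_max0X.
  + by rewrite /= maxxx expr0n/= mulr0.
Unshelve. all: by end_near.
Qed.

Section periodic_bump.
Context {R : realType}.
Implicit Types (N a x : R).

(** The bump of width [1 / N] around [a] is built from the sine of the half
    angle, which is periodic up to sign and vanishes only at the translates of
    [a] by multiples of [2 pi]: no periodization is needed. *)
Definition wave N a x : R := N * sin ((x - a) / 2).

Definition bump N a (L : nat) x : R := Num.max 0 (1 - wave N a x ^+ 2) ^+ L.

(** The derivatives of [bump] stay in the span of these products. Their
    coefficients are linear in [N], and [i] drops by at most one at each
    derivation. *)
Definition bump_monomial N a (i j k : nat) x : R :=
  bump N a i x * wave N a x ^+ j * cos ((x - a) / 2) ^+ k.

Lemma is_derive_half_shift (f : R -> R) a x (d : R) :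
  is_derive ((x - a) / 2) 1 f d -> is_derive x 1 (fun y => f ((y - a) / 2)) (d / 2).
Proof.
move=> df; apply: (@is_derive1_comp _ f (fun y => (y - a) / 2)).
have -> : (fun y : R => (y - a) / 2) = (2^-1 \*: shift (- a)).
  by apply/funext => y; rewrite /= mulrC.
by apply: is_derive_eq; rewrite subr0 /GRing.scale/= mulr1.
Qed.

Lemma is_derive_wave N a x :
  is_derive x 1 (wave N a) (N / 2 * cos ((x - a) / 2)).
Proof.
have := is_deriveZ N (is_derive_half_shift _ a x _ (is_derive_sin _)).
by move=> h; apply: (is_derive_eq h); rewrite /GRing.scale/=; ring.
Qed.

Lemma is_derive_bump N a (i : nat) x :
  is_derive x 1 (bump N a i.+2)
    (- (i.+2%:R * N) * (bump N a i.+1 x * wave N a x * cos ((x - a) / 2))).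
Proof.
have dw : is_derive x 1 (fun y => 1 - wave N a y ^+ 2)
    (- (2%:R * wave N a x ^+ 1) *: (N / 2 * cos ((x - a) / 2))).
  have := is_deriveB (is_derive_cst (1 : R) x (1 : R))
     (is_deriveX 2 (is_derive_wave N a x)).
  by move=> h; apply: (is_derive_eq h); rewrite sub0r scaleNr.
have := @is_derive1_comp _ (fun y => Num.max 0 y ^+ i.+2)
  (fun y => 1 - wave N a y ^+ 2) _ _ _ (is_derive_max0X i _) dw.
by move=> h; apply: (is_derive_eq h); rewrite /GRing.scale/= /bump; field.
Qed.

Lemma is_derive_bump_monomial N a (i j k : nat) x : N != 0 ->
  is_derive x 1 (bump_monomial N a i.+2 j k)
    (- (i.+2%:R * N) * bump_monomial N a i.+1 j.+1 k.+1 x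
     + (j%:R * (N / 2) * bump_monomial N a i.+2 j.-1 k.+1 x
        + - (k%:R / (2 * N)) * bump_monomial N a i.+2 j.+1 k.-1 x)).
Proof.
move=> N0.
have dB := is_derive_bump N a i x.
have dS := is_deriveX j (is_derive_wave N a x).
have dC := is_deriveX k (is_derive_half_shift _ a x _ (is_derive_cos _)).
have prodE : bump_monomial N a i.+2 j k =
    bump N a i.+2 * wave N a ^+ j * (fun y => cos ((y - a) / 2)) ^+ k.
  by apply/funext => y; rewrite !fctE.
rewrite prodE; have := is_deriveM (is_deriveM dB dS) dC.
move=> h; apply: (is_derive_eq h); rewrite /GRing.scale/= /bump_monomial !fctE.
have -> : sin ((x - a) / 2) = wave N a x / N by rewrite /wave; field.
by rewrite !exprS; field.
Qed.

Lemma bump_ge0 N a (L : nat) x : 0 <= bump N a L x.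
Proof. by rewrite exprn_ge0// le_max lexx. Qed.

Lemma bump_le1 N a (L : nat) x : bump N a L x <= 1.
Proof.
rewrite exprn_ile1// ?le_max ?lexx// ge_max ler01/=.
by rewrite lerBlDr lerDl sqr_ge0.
Qed.

Lemma bump_eq0 N a (L : nat) x : 1 <= `|wave N a x| -> bump N a L.+1 x = 0.
Proof.
move=> w1; rewrite /bump max_l ?expr0n// subr_le0 -[leRHS]real_normK ?num_real//.
by rewrite expr_ge1.
Qed.

(** Where the first factor is nonzero, [wave] lies between -1 and 1; this is why
    [i] has to stay positive. *)
Lemma bump_monomial_le1 N a (i j k : nat) x : `|bump_monomial N a i.+1 j k x| <= 1.
Proof.
rewrite /bump_monomial; have [w1|w1] := leP 1 `|wave N a x|.
  by rewrite bump_eq0// !mul0r normr0.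
move: (bump_ge0 N a i.+1 x) (bump_le1 N a i.+1 x); move: (bump _ _ _ _) => b b0 b1.
rewrite !normrM (ger0_norm b0) !normrX.
by rewrite !mulr_ile1 ?mulr_ge0 ?exprn_ge0 ?exprn_ile1 ?cos_max ?(ltW w1).
Qed.

(** The constant [M] does not depend on the width: only the factor [N ^ l] that
    scaling predicts appears. *)
Lemma bump_monomial_deriv_bounded (l i j k : nat) : (l < i)%N ->
  exists2 M : R, 0 <= M &
    forall N a, 1 <= N -> deriv_bounded l (M * N ^+ l) (bump_monomial N a i j k).
Proof.
elim: l i j k => [|l IH] i j k li.
  exists 1 => // N a _ /= x; rewrite mul1r -(prednK li).
  exact: bump_monomial_le1.
case: i li => [//|[//|i]] li.
have [M1 M10 b1] := IH i.+1 j.+1 k.+1 li.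
have [M2 M20 b2] := IH i.+2 j.-1 k.+1 (ltnW li).
have [M3 M30 b3] := IH i.+2 j.+1 k.-1 (ltnW li).
exists (i.+2%:R * M1 + (j%:R * M2 + k%:R * M3)).
  by rewrite !addr_ge0// mulr_ge0.
move=> N a N1; have N0 : 0 < N := lt_le_trans ltr01 N1.
eexists; first by move=> x; apply: is_derive_bump_monomial; rewrite gt_eqF.
apply: deriv_bounded_le; last first.
  apply: deriv_boundedD; first exact/deriv_boundedZ/b1.
  by apply: deriv_boundedD; apply/deriv_boundedZ; [exact: b2|exact: b3].
have -> : (i.+2%:R * M1 + (j%:R * M2 + k%:R * M3)) * N ^+ l.+1 =
    i.+2%:R * N * (M1 * N ^+ l) +
    (j%:R * N * (M2 * N ^+ l) + k%:R * N * (M3 * N ^+ l)) by rewrite exprS; ring.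
have X0 : 0 <= N ^+ l by rewrite exprn_ge0// ltW.
have iN0 : 0 <= N / 2 by lra.
have iN1 : N / 2 <= N by lra.
have vN0 : 0 <= (2 * N)^-1 by rewrite invr_ge0; lra.
have vN1 : (2 * N)^-1 <= N.
  by rewrite (le_trans _ N1)// invf_le1; lra.
apply: lerD; last apply: lerD; apply: ler_wpM2r; rewrite ?mulr_ge0//.
- by rewrite normrN ger0_norm// mulr_ge0// ltW.
- by rewrite ger0_norm ?ler_wpM2l//; exact: mulr_ge0.
- by rewrite normrN ger0_norm ?ler_wpM2l//; exact: mulr_ge0.
Qed.

Lemma continuous_wave N a : continuous (wave N a).
Proof.
move=> x; apply: differentiable_continuous; apply/derivable1_diffP.
by apply: ex_derive; exact: is_derive_wave.
Qed.

Lemma continuous_bump N a L : continuous (bump N a L).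
Proof.
move=> x; apply: (@cvg_comp _ _ _ (fun x => 1 - wave N a x ^+ 2)
  (fun y => Num.max 0 y ^+ L)); last exact: continuous_max0X.
apply: cvgB; first exact: cvg_cst.
apply: (@cvg_comp _ _ _ (wave N a) (fun y => y ^+ 2)); last exact: exprn_continuous.
exact: continuous_wave.
Qed.

Lemma bump_periodic N a L x : bump N a L (x + 2 * pi) = bump N a L x.
Proof.
rewrite /bump /wave (_ : (x + 2 * pi - a) / 2 = (x - a) / 2 + pi); last by field.
by rewrite sinDpi mulrN sqrrN.
Qed.

End periodic_bump.

(** * Sine estimates *)

Section sine_estimates.
Context {R : realType}.
Implicit Types (x y u v : R).

Lemma normr_sinB_le u v : `|sin (u - v)| <= `|sin u| + `|sin v|.
Proof.
rewrite sinB (le_trans (ler_normB _ _))// !normrM lerD//.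
  by rewrite ler_piMr ?cos_max.
by rewrite ler_piMl ?cos_max.
Qed.

Lemma normr_sin_double_le (k : nat) u : `|sin (2 ^+ k * u)| <= 2 ^+ k * `|sin u|.
Proof.
elim: k => [|k IH]; first by rewrite !mul1r.
rewrite exprS -!mulrA mulr_natl sin_mulr2n normrMn mulr_natl lerMn2r/=.
by rewrite normrM (le_trans _ IH)// ler_piMl// cos_max.
Qed.

Lemma normr_sin_addpi (k : nat) u : `|sin (u + k%:R * pi)| = `|sin u|.
Proof.
elim: k => [|k IH]; first by rewrite mul0r addr0.
by rewrite -natr1 mulrDl mul1r addrA sinDpi normrN.
Qed.

Lemma normr_sin_addpi_int (z : int) u : `|sin (u + z%:~R * pi)| = `|sin u|.
Proof.
case: z => k; first exact: normr_sin_addpi.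
by rewrite -[LHS](normr_sin_addpi k.+1) NegzE mulrNz mulNr addrNK.
Qed.

(** Doubling the angle at most doubles the sine, and some power-of-two multiple
    of [pi * j / 2 ^ s] is an odd multiple of [pi / 2]. *)
Lemma sin_dyadic_ge (s j : nat) : ~~ (2 ^ s %| j)%N ->
  2 / 2 ^+ s <= `|sin (pi * j%:R / 2 ^+ s)| :> R.
Proof.
elim: s j => [|s IH] j; first by rewrite expn0 dvd1n.
have p0 : 0 < 2 ^+ s :> R by rewrite exprn_gt0.
case: (boolP (odd j)) => [oj _|ej].
  have -> : 2 / 2 ^+ s.+1 = 1 / 2 ^+ s :> R.
    by rewrite exprS; field; rewrite gt_eqF.
  rewrite ler_pdivrMr// mulrC; apply: le_trans (normr_sin_double_le s _).
  have -> : 2 ^+ s * (pi * j%:R / 2 ^+ s.+1) = pi / 2 + j./2%:R * pi :> R.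
    rewrite -{1}(odd_double_half j) oj natrD -mul2n natrM exprS/=.
    by field; rewrite gt_eqF.
  by rewrite normr_sin_addpi sin_pihalf normr1.
rewrite -(even_halfK ej) -mul2n expnS dvdn_pmul2l// => /IH.
have -> : pi * (2 * j./2)%:R / 2 ^+ s.+1 = pi * j./2%:R / 2 ^+ s :> R.
  by rewrite natrM exprS; field; rewrite gt_eqF.
apply: le_trans; have -> : 2 / 2 ^+ s.+1 = 1 / 2 ^+ s :> R.
  by rewrite exprS; field; rewrite gt_eqF.
by rewrite ler_pM2r ?invr_gt0// ler1n.
Qed.

Lemma sin_le_id y : 0 <= y -> `|sin y| <= y.
Proof.
move=> y0; have [z] := mean_value _ _ 0 y (fun z => is_derive_sin z).
rewrite sin0 !subr0 => ->; rewrite normrM (ger0_norm y0).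
by rewrite ler_piMl ?cos_max.
Qed.

Lemma sin_ge_quarter y : 0 <= y <= pi / 2 -> y / 4 <= sin y.
Proof.
move=> /andP[y0 yp].
have p4 : cos (pi / 4) ^+ 2 = 1 / 2 :> R.
  have := cos_mulr2n (pi / 4 : R).
  have -> : pi / 4 *+ 2 = pi / 2 :> R by rewrite mulr2n; field.
  by rewrite cos_pihalf mulr2n; lra.
have p2 := @pihalf_lt2 R; have p0 := @pi_gt0 R.
have c4 : 1 / 2 <= cos (pi / 4) :> R.
  by have := @cos_ge0_pihalf R (pi / 4) ltac:(lra); nra.
have s4 : 1 / 2 <= sin (pi / 4) :> R.
  have := @sin_ge0_pi R (pi / 4) ltac:(lra).
  by have := sin2cos2 (pi / 4 : R); nra.
have [y4|y4] := leP y (pi / 4).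
  have cf : {within `[0, y], continuous (@sin R)}.
    by apply: continuous_subspaceT => ?; exact: continuous_sin.
  have [z] := MVT_segment y0 (fun z _ => is_derive_sin z) cf.
  rewrite in_itv/= sin0 !subr0 => /andP[z0 zy] ->.
  have : cos (pi / 4) <= cos z.
    by rewrite leNgt ltr_cos ?in_itv/= -?leNgt; lra.
  nra.
have : sin (pi / 4) <= sin y by rewrite leNgt ltr_sin ?in_itv/= -?leNgt; lra.
lra.
Qed.

End sine_estimates.

(** * Measure of the supports *)

Section circle_measure.
Context {R : realType}.
Local Notation mR := (measurableTypeR R).
Implicit Types (A B : set mR) (N a x t : R).

Lemma circle_probE A : measurable A ->
  circle_prob A =
  ((2 * pi)^-1%:E * lebesgue_measure (A `&` `[0%R, (2 * pi)%R]%classic))%E.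
Proof.
move=> mA; rewrite [LHS]/(uniform_prob _ _) integral_uniform_pdf.
rewrite (eq_integral (cst (2 * pi)^-1%:E)) => [|x].
  by rewrite integral_cst//; exact: measurableI.
by rewrite inE => -[_ /=]; rewrite in_itv/= /uniform_pdf subr0 => ->.
Qed.

Lemma circle_prob_itv_ge A u v : measurable A -> u <= v ->
  `[u, v] `<=` A -> `[u, v] `<=` `[0, (2 * pi)%R] ->
  (((v - u) / (2 * pi))%:E <= circle_prob A)%E.
Proof.
move=> mA uv uvA uvI; rewrite circle_probE// mulrC EFinM.
rewrite lee_pmul2l ?lte_fin ?invr_gt0 ?two_pi_gt0//.
have -> : ((v - u)%:E = lebesgue_measure `[u, v])%E.
  rewrite lebesgue_measure_itv/= lte_fin -EFinB; move: uv.
  by rewrite le_eqVlt => /predU1P[->|->]//; rewrite ltxx subrr.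
by apply: le_measure; rewrite ?inE//; [exact: measurableI|move=> x; split; auto].
Qed.

Definition bump_support N a : set R := [set x | `|wave N a x| < 1].

Lemma measurable_bump_support N a : measurable (bump_support N a : set mR).
Proof.
apply: open_measurable; rewrite (_ : bump_support _ _ = wave N a @^-1` `]-1, 1[).
  apply: open_comp; last exact: interval_open.
  by move=> x _; exact: continuous_wave.
by apply/seteqP; split => x; rewrite /bump_support/= in_itv/= ltr_norml.
Qed.

Lemma bump_support_shift N a t x :
  bump_support N a (x + t) <-> bump_support N (a - t) x.
Proof. by rewrite /bump_support/= /wave opprB addrA addrAC. Qed.

Lemma bump_support_center_mod N a :
  exists2 b, 0 <= b <= 2 * pi & bump_support N a = bump_support N b.
Proof.
have tp0 := @two_pi_gt0 R.
pose z := Num.floor (a / (2 * pi)).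
have /andP[z1 z2] := floor_itv (a / (2 * pi)).
exists (a - z%:~R * (2 * pi)).
  rewrite -{1 2}(divfK (lt0r_neq0 tp0) a) -mulrBl; apply/andP; split.
    by rewrite mulr_ge0 ?subr_ge0// ltW.
  by rewrite ler_piMl 1?ltW// ltrBlDl; rewrite intrD in z2.
apply/seteqP; split => x; rewrite /bump_support/= /wave !normrM;
have -> : (x - (a - z%:~R * (2 * pi))) / 2 = (x - a) / 2 + z%:~R * pi by field.
- by rewrite normr_sin_addpi_int.
- by rewrite normr_sin_addpi_int.
Qed.

Lemma lebesgue_itvoo_le u v : u <= v ->
  (lebesgue_measure (`]u, v[%classic : set R) <= (v - u)%:E)%E.
Proof.
by move=> uv; rewrite lebesgue_measure_itv/=; case: ifP => // _; rewrite lee_fin subr_ge0.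
Qed.

(** Up to a period the centre lies between 0 and [2 pi]. On that interval the
    support then lies near the centre or one of its two neighbouring translates,
    because the sine is at least a quarter of its argument up to [pi / 2]. *)
Lemma circle_prob_bump_support_le N a : 1 <= N ->
  (circle_prob (bump_support N a : set mR) <= (12 / N)%:E)%E.
Proof.
move=> N1; have N0 : 0 < N := lt_le_trans ltr01 N1.
have [b /andP[b0 b2] ->] := bump_support_center_mod N a.
have tp0 := @two_pi_gt0 R; have p0 := @pi_gt0 R.
have e0 : 0 < 8 / N by rewrite divr_gt0.
pose J c : set mR := `]c - 8 / N, c + 8 / N[%classic.
have mJ c : measurable (J c) by exact: measurable_itv.
have JE c : (lebesgue_measure (J c) <= (16 / N)%:E)%E.
  apply: le_trans (lebesgue_itvoo_le _ _ _) _; first by lra.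
  by rewrite lee_fin; lra.
have sub : bump_support N b `&` `[0, (2 * pi)%R] `<=`
    J b `|` (J (b - 2 * pi) `|` J (b + 2 * pi)).
  move=> x [] /=; rewrite /bump_support/= /wave normrM (gtr0_norm N0) in_itv/=.
  move=> + /andP[x0 x2]; set y := (x - b) / 2.
  rewrite mulrC -ltr_pdivlMr// div1r => sy.
  have xE : x = b + 2 * y by rewrite /y; field.
  have small u : 0 <= u <= pi / 2 -> sin u < N^-1 -> u < 4 / N.
    by move=> up su; have := sin_ge_quarter _ up; lra.
  have Jx c : `|x - c| < 8 / N -> J c x.
    by rewrite /J/= in_itv/= ltr_distl.
  have [yn|yp] := leP y 0.
  - have [y1|y1] := leP (- (pi / 2)) y.
      left; apply: Jx; rewrite xE addrC addKr -normrN ger0_norm ?oppr_ge0; last by lra.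
      have : - y < 4 / N.
        apply: small; first by lra.
        by rewrite sinN; apply: le_lt_trans (ler_norm _) _; rewrite normrN.
      by lra.
    right; left; apply: Jx; rewrite xE.
    have yl : - pi <= y by rewrite /y; lra.
    have : y + pi < 4 / N.
      apply: small; first by lra.
      by rewrite sinDpi; apply: le_lt_trans (ler_norm _) _; rewrite normrN.
    by rewrite ger0_norm; lra.
  - have [y1|y1] := leP y (pi / 2).
      left; apply: Jx; rewrite xE addrC addKr ger0_norm; last by lra.
      have : y < 4 / N.
        apply: small; first by lra.
        exact: le_lt_trans (ler_norm _) _.
      by lra.
    right; right; apply: Jx; rewrite xE.
    have yl : y <= pi by rewrite /y; lra.
    have : pi - y < 4 / N.
      apply: small; first by lra.
      by rewrite addrC sinDpi sinN opprK; apply: le_lt_trans (ler_norm _) _.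
    by rewrite -normrN ger0_norm; lra.
rewrite circle_probE; last exact: measurable_bump_support.
have -> : 12 / N = (4)^-1 * (48 / N) by field; rewrite gt_eqF.
rewrite EFinM; apply: lee_pmul.
- by rewrite lee_fin invr_ge0 ltW.
- exact: measure_ge0.
- by rewrite lee_fin lef_pV2 ?posrE//; have := @pi_ge2 R; lra.
have mJJ : measurable (J (b - 2 * pi) `|` J (b + 2 * pi)) by exact: measurableU.
apply: (@le_trans _ _ (lebesgue_measure (J b `|` (J (b - 2 * pi) `|` J (b + 2 * pi))))).
  apply: le_measure; rewrite ?inE//; last exact: measurableU.
  by apply: measurableI => //; exact: measurable_bump_support.
rewrite (_ : 48 / N = 16 / N + (16 / N + 16 / N)); last by ring.
rewrite !EFinD.
apply: (@le_trans _ _ (lebesgue_measure (J b) +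
    lebesgue_measure (J (b - 2 * pi)%R `|` J (b + 2 * pi)%R))%E).
  exact: measureU2.
apply: leeD => //.
apply: (@le_trans _ _ (lebesgue_measure (J (b - 2 * pi)%R) +
    lebesgue_measure (J (b + 2 * pi)%R))%E); first exact: measureU2.
exact: leeD.
Qed.

(** A difference of order [l] at [x] only sees the values at [x + i t] for
    [i] up to [l], so the translates of the support by [- i t] carry it. *)
Definition diff_support N a t (l : nat) : set mR :=
  \big[setU/set0]_(i < l.+1) bump_support N (a - i%:R * t).

Lemma measurable_diff_support N a t l : measurable (diff_support N a t l).
Proof. by apply: bigsetU_measurable => i _; exact: measurable_bump_support. Qed.

Lemma circle_prob_diff_support_le N a t l : 1 <= N ->
  (circle_prob (diff_support N a t l) <= (l.+1%:R * 12 / N)%:E)%E.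
Proof.
move=> N1; rewrite /diff_support.
apply: (@le_trans _ _
    (\sum_(i < l.+1) circle_prob (bump_support N (a - i%:R * t)%R : set mR))%E).
  apply: (Boole_inequality circle_prob
    (A := fun i => bump_support N (a - i%:R * t) : set mR)) => i _.
  exact: measurable_bump_support.
apply: (@le_trans _ _ (\sum_(i < l.+1) (12 / N)%:E)%E).
  by apply: lee_sum => i _; exact: circle_prob_bump_support_le.
by rewrite sumEFin lee_fin sumr_const card_ord -mulrA -[leLHS]mulr_natl.
Qed.

Lemma iter_fdiff_bump_eq0 N a t l L x : ~ diff_support N a t l x ->
  iter l (fdiff t) (bump N a L.+1) x = 0.
Proof.
move=> xS; apply: iter_fdiff_eq0 => i il; apply: bump_eq0; rewrite leNgt.
apply/negP => xi; apply: xS; rewrite /diff_support.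
rewrite -(bigcup_mkord l.+1 (fun i => bump_support N (a - i%:R * t) : set mR)).
by exists i => //=; apply/bump_support_shift.
Qed.

(** The sine is at most its argument, so [wave] is at most one half there. *)
Lemma bump_center_ge N a L x : 0 < N -> `|x - a| <= N^-1 ->
  (3 / 4) ^+ L <= bump N a L x.
Proof.
move=> N0 xa; have w : wave N a x ^+ 2 <= 1 / 4.
  rewrite /wave -real_normK ?num_real// normrM (gtr0_norm N0).
  have s : `|sin ((x - a) / 2)| <= N^-1 / 2.
    rewrite -[(x - a) / 2]opprK; case: (leP 0 (x - a)) => xa0.
      rewrite opprK; apply: le_trans (sin_le_id _ _) _; first by lra.
      by move: xa; rewrite ger0_norm//; lra.
    rewrite sinN normrN; apply: le_trans (sin_le_id _ _) _; first by lra.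
    by move: xa; rewrite ltr0_norm//; lra.
  have : N * `|sin ((x - a) / 2)| <= 1 / 2.
    rewrite (_ : 1 / 2 = N * (N^-1 / 2)) ?ler_pM2l//.
    by field; rewrite gt_eqF.
  have : 0 <= N * `|sin ((x - a) / 2)| by rewrite mulr_ge0// ltW.
  by nra.
rewrite /bump; apply: lerXn2r; rewrite ?nnegrE ?le_max; [lra|by rewrite lexx|].
by apply/orP; right; lra.
Qed.

End circle_measure.

(** * Estimates of L_p norms *)

Section lnorm_estimates.
Context {R : realType} {d : measure_display} {T : measurableType d}.
Variable mu : {measure set T -> \bar R}.
Implicit Types (f g : T -> R) (p : R).
Local Notation N p f := (Lnorm mu p%:E (EFin \o f%R)).

Lemma measurable_normr_powR f p : measurable_fun setT f ->
  measurable_fun setT (fun x => (`|f x| `^ p)%:E).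
Proof.
move=> mf; apply/measurable_EFinP.
apply: (measurableT_comp (measurable_powR p)).
exact: measurableT_comp.
Qed.

Lemma Lnorm_EFinE f p :
  N p f = ((\int[mu]_x (`|f x| `^ p)%:E) `^ p^-1)%E.
Proof. by rewrite unlock; under eq_integral do rewrite poweR_EFin. Qed.

Lemma le_Lnorm f g p : 0 < p -> measurable_fun setT f -> measurable_fun setT g ->
  (forall x, `|f x| <= `|g x|) -> (N p f <= N p g)%E.
Proof.
move=> p0 mf mg fg; rewrite !Lnorm_EFinE.
apply: gt0_ler_poweR; first by rewrite invr_ge0 ltW.
- by rewrite in_itv/= leey andbT integral_ge0// => x _; rewrite lee_fin powR_ge0.
- by rewrite in_itv/= leey andbT integral_ge0// => x _; rewrite lee_fin powR_ge0.
apply: ge0_le_integral => //.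
- exact: measurable_normr_powR.
- exact: measurable_normr_powR.
- by move=> x _; rewrite lee_fin ge0_ler_powR ?nnegrE// ltW.
Qed.

Lemma Lnorm_indic_le (B : set T) (k b p : R) : 0 < p -> measurable B -> 0 <= k ->
  (mu B <= b%:E)%E -> (N p (fun x => k * \1_B x) <= (k * b `^ p^-1)%:E)%E.
Proof.
move=> p0 mB k0 muB.
have b0 : 0 <= b by rewrite -lee_fin (le_trans _ muB)// measure_ge0.
rewrite Lnorm_EFinE.
have -> : (\int[mu]_x (`|k * \1_B x| `^ p)%:E = (k `^ p)%:E * mu B)%E.
  rewrite -[in RHS](setIT B) -integral_indic//.
  rewrite -ge0_integralZl//; last by rewrite lee_fin powR_ge0.
    apply: eq_integral => x _; rewrite indicE; case: (x \in B) => /=.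
      by rewrite !mulr1 ger0_norm// mule1.
    by rewrite !mulr0 normr0 powR0 ?gt_eqF// mule0.
  by apply/measurable_EFinP; exact: measurable_indic.
rewrite -{2}(powRr1 k0) -(divff (lt0r_neq0 p0)) powRrM -powRM ?powR_ge0//.
rewrite -[leRHS]poweR_EFin; apply: gt0_ler_poweR; first by rewrite invr_ge0 ltW.
- by rewrite in_itv/= leey andbT mule_ge0// lee_fin powR_ge0.
- by rewrite in_itv/= leey andbT lee_fin mulr_ge0// powR_ge0.
- by rewrite EFinM lee_pmul// lee_fin powR_ge0.
Qed.

(** Minkowski's inequality; a sum over overlapping boxes costs no more than the
    sum of the norms. *)
Lemma Lnorm_sum_indic_le (I : Type) (r : seq I) (B : I -> set T) (k b : I -> R)
    f p : 1 <= p -> measurable_fun setT f ->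
  (forall i, measurable (B i)) -> (forall i, 0 <= k i) ->
  (forall i, mu (B i) <= (b i)%:E)%E ->
  (forall x, `|f x| <= \sum_(i <- r) k i * \1_(B i) x) ->
  (N p f <= (\sum_(i <- r) k i * b i `^ p^-1)%:E)%E.
Proof.
move=> p1 mf mB k0 muB fB; have p0 : 0 < p := lt_le_trans ltr01 p1.
have mk i : measurable_fun setT (fun x => k i * \1_(B i) x).
  by apply: measurable_funM => //; exact: measurable_indic.
apply: (@le_trans _ _ (N p (fun x => \sum_(i <- r) k i * \1_(B i) x))).
  apply: le_Lnorm => //; first exact: measurable_sum.
  by move=> x; apply: le_trans (fB x) (ler_norm _).
elim: r {fB} => [|i r IH].
  rewrite big_nil (_ : EFin \o _ = cst 0%E) ?Lnorm0 ?eqe ?gt_eqF//.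
  by apply/funext => x; rewrite /= big_nil.
rewrite big_cons EFinD.
rewrite (_ : (fun x => \sum_(j <- i :: r) k j * \1_(B j) x) =
    (fun x => k i * \1_(B i) x) \+ (fun x => \sum_(j <- r) k j * \1_(B j) x)).
  apply: le_trans (minkowski_EFin mu (mk i) _ p1) _; first exact: measurable_sum.
  by apply: leeD => //; exact: Lnorm_indic_le.
by apply/funext => x; rewrite big_cons.
Qed.

(** The [p]-th powers of the norms add up even when the sets overlap: a point
    lying in [n] of them contributes [n ^ p], which is at least [n]. *)
Lemma Lnorm_sum_indic_ge (I : Type) (r : seq I) (B : I -> set T) (b : I -> R)
    (c : R) f p : 1 <= p -> measurable_fun setT f ->
  (forall i, measurable (B i)) -> 0 <= c -> (forall i, 0 <= b i) ->
  (forall i, (b i)%:E <= mu (B i))%E ->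
  (forall x, c * \sum_(i <- r) \1_(B i) x <= `|f x|) ->
  ((c * (\sum_(i <- r) b i) `^ p^-1)%:E <= N p f)%E.
Proof.
move=> p1 mf mB c0 b0 muB fB; have p0 : 0 < p := lt_le_trans ltr01 p1.
have sb0 : 0 <= \sum_(i <- r) b i by exact: sumr_ge0.
rewrite Lnorm_EFinE -{1}(powRr1 c0) -(divff (lt0r_neq0 p0)) powRrM.
rewrite -powRM ?powR_ge0// -poweR_EFin.
apply: gt0_ler_poweR; first by rewrite invr_ge0 ltW.
- by rewrite in_itv/= leey andbT lee_fin mulr_ge0// powR_ge0.
- by rewrite in_itv/= leey andbT integral_ge0// => x _; rewrite lee_fin powR_ge0.
have mI i : measurable_fun setT (fun x => (\1_(B i) x)%:E : \bar R).
  by apply/measurable_EFinP; exact: measurable_indic.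
have mS : measurable_fun setT (fun x => (\sum_(i <- r) \1_(B i) x)%:E : \bar R).
  by apply/measurable_EFinP/measurable_sum => i; exact: measurable_indic.
have S0 x : 0 <= \sum_(i <- r) \1_(B i) x :> R by apply: sumr_ge0.
apply: (@le_trans _ _ (\int[mu]_x ((c `^ p)%:E * (\sum_(i <- r) \1_(B i) x)%:E))%E).
  rewrite ge0_integralZl ?lee_fin ?powR_ge0//; last by move=> x _; rewrite lee_fin.
  rewrite EFinM lee_wpmul2l ?lee_fin ?powR_ge0//.
  under eq_integral do rewrite -sumEFin.
  rewrite -sumEFin ge0_integral_sum//.
  by apply: lee_sum => i _; rewrite integral_indic// setIT.
apply: ge0_le_integral => //.
- by move=> x _; rewrite mule_ge0// lee_fin// powR_ge0.
- exact: emeasurable_funM.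
- exact: measurable_normr_powR.
move=> x _; rewrite -EFinM lee_fin.
apply: (@le_trans _ _ ((c * \sum_(i <- r) \1_(B i) x) `^ p)); last first.
  by apply: ge0_ler_powR; rewrite ?nnegrE ?mulr_ge0// ltW.
rewrite powRM// ler_wpM2l ?powR_ge0//.
rewrite (eq_bigr (fun i => (x \in B i)%:R)) => [|i _]; last by rewrite indicE.
rewrite -natr_sum; case: (\sum_(i <- r) _)%N => [|n]; first exact: powR_ge0.
by rewrite le1r_powR// ler1n.
Qed.

Lemma LnormZ_ge0 (c : R) f p : 0 < p -> 0 <= c -> measurable_fun setT f ->
  N p (fun x => c * f x) = (c%:E * N p f)%E.
Proof.
move=> p0 c0 mf; rewrite !Lnorm_EFinE.
under eq_integral do rewrite normrM powRM// EFinM.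
have i0 : (0 <= \int[mu]_x (`|f x| `^ p)%:E)%E.
  by apply: integral_ge0 => x _; rewrite lee_fin powR_ge0.
rewrite ge0_integralZl ?lee_fin ?powR_ge0//.
- rewrite poweRM ?lee_fin ?powR_ge0// poweR_EFin -powRrM divff ?gt_eqF//.
  by rewrite ger0_norm// powRr1.
- exact: measurable_normr_powR.
Qed.

End lnorm_estimates.

(** * Product sets in the torus *)

Section torus_boxes.
Context {R : realType}.

Lemma lee_prod (I : Type) (s : seq I) (f g : I -> \bar R) :
  (forall i, 0 <= f i)%E -> (forall i, f i <= g i)%E ->
  (\prod_(i <- s) f i <= \prod_(i <- s) g i)%E.
Proof.
move=> f0 fg; elim: s => [|i s IH]; first by rewrite !big_nil.
by rewrite !big_cons lee_pmul// prode_ge0.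
Qed.

Local Notation mR := (measurableTypeR R).

Definition tuple_box (d : nat) (B : 'I_d -> set mR) : set (d.-tuple mR) :=
  [set u | forall j, B j (tnth u j)].

Lemma measurable_tuple_box (d : nat) (B : 'I_d -> set mR) :
  (forall j, measurable (B j)) -> measurable (tuple_box d B).
Proof.
move=> mB; rewrite (_ : tuple_box d B =
    \bigcap_(j in setT) ((fun u : d.-tuple mR => tnth u j) @^-1` B j)).
  apply: fin_bigcap_measurable; first exact: finite_finset.
  move=> j _; rewrite -[_ @^-1` _]setTI; exact: measurable_tnth.
by apply/seteqP; split => u /= H j; [move=> _; exact: H|exact: (H j I)].
Qed.

Lemma torus_prob_box (d : nat) (B : 'I_d -> set mR) :
  (forall j, measurable (B j)) ->
  torus_prob d (tuple_box d B) = (\prod_(j < d) circle_prob (B j))%E.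
Proof.
elim: d B => [|d IH] B mB.
  rewrite big_ord0 /= diracE mem_set//; by case.
have mB' : measurable (tuple_box d (fun j => B (lift ord0 j))).
  exact: measurable_tuple_box.
rewrite big_ord_recl -IH// -product_measure1E//=.
rewrite /pushforward; congr (_ _); apply/seteqP; split => -[x u] /=.
  move=> H; split; first exact: (H ord0).
  by move=> j; have := H (lift ord0 j); rewrite tnthS.
move=> [H0 H] j; case: (unliftP ord0 j) => [i|] ->; last exact: H0.
by have := H i; rewrite /= tnthS.
Qed.

End torus_boxes.

(** * Dyadic sums *)

Section dyadic_sums.
Context {R : realType}.

Lemma geometric_sum_le (x : R) (n : nat) : 0 <= x < 1 ->
  \sum_(i < n) x ^+ i <= (1 - x)^-1.
Proof.
move=> /andP[x0 x1]; have x1' : 0 < 1 - x by rewrite subr_gt0.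
elim: n => [|n IH]; first by rewrite big_ord0 invr_ge0 ltW.
rewrite big_ord_recl expr0; under eq_bigr do rewrite exprS.
rewrite -mulr_sumr [leRHS](_ : _ = 1 + x * (1 - x)^-1).
  by rewrite lerD2l ler_wpM2l.
by field; rewrite gt_eqF.
Qed.

Lemma two_powR_gt1 (a : R) : 0 < a -> 1 < 2 `^ a.
Proof.
move=> a0; rewrite -[ltLHS](congr1 (@^~ a) (powR1 R)).
rewrite gt0_ltr_powR ?nnegrE ?ler0n ?ler01//.
by rewrite ltr1n.
Qed.

Lemma two_powRN_itv (r : R) : 0 < r -> 0 < 2 `^ (- r) < 1.
Proof.
move=> r0; rewrite powR_gt0//= powRN invf_lt1 ?powR_gt0//.
exact: two_powR_gt1.
Qed.

(** The terms grow geometrically while [2 ^ i * u < 1] and decay geometrically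
    afterwards, because [0 < r < l]. Removing the first term turns [u] into
    [2 * u], which gives an induction on [n]. *)
Lemma dyadic_min_sum_le (r : R) (l : nat) : 0 < r -> r < l%:R ->
  exists2 D : R, 1 <= D & forall (n : nat) (u : R), 0 <= u ->
    \sum_(i < n) (2 `^ (- r)) ^+ i * Num.min 1 ((2 ^+ i * u) ^+ l) <= D * u `^ r.
Proof.
move=> r0 rl; set x := 2 `^ (- r).
have /andP[x0 x1] : 0 < x < 1 := two_powRN_itv r r0.
have l0 : (0 < l)%N by rewrite -(ltr0n R) (lt_trans r0).
have xl : 1 < x * 2 ^+ l.
  rewrite -powR_mulrn// -powRD; last by rewrite pnatr_eq0 implybT.
  by rewrite two_powR_gt1// addrC subr_gt0.
pose T n u := \sum_(i < n) x ^+ i * Num.min 1 ((2 ^+ i * u) ^+ l).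
have TS n u : T n.+1 u = Num.min 1 (u ^+ l) + x * T n (2 * u).
  rewrite /T big_ord_recl !expr0 !mul1r mulr_sumr; congr (_ + _).
  by apply: eq_bigr => i _; rewrite !exprS mulrA mulrA [2 ^+ i * 2]mulrC.
pose D1 := (1 - x)^-1; pose E := (x * 2 ^+ l - 1)^-1.
have E0 : 0 < E by rewrite invr_gt0 subr_gt0.
have EE : E * (x * 2 ^+ l) = E + 1.
  by rewrite -[x * _](subrK 1) mulrDr mulr1 mulVf ?subr_eq0 ?gt_eqF// addrC.
have D10 : 1 <= D1 by rewrite invf_ge1 ?subr_gt0// gerBl ltW.
have T1 n u : T n u <= D1.
  apply: (@le_trans _ _ (\sum_(i < n) x ^+ i)).
    apply: ler_sum => i _; rewrite ler_piMr ?exprn_ge0 ?(ltW x0)//.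
    by rewrite ge_min lexx.
  by apply: geometric_sum_le; rewrite ltW.
have Tlarge n u : 1 <= u -> T n u <= D1 * u `^ r.
  move=> u1; apply: (le_trans (T1 n u)); rewrite ler_peMr//; first lra.
  rewrite -[leLHS](congr1 (@^~ r) (powR1 R)).
  by rewrite ge0_ler_powR ?nnegrE ?(ltW r0) ?ler01 ?(le_trans ler01 u1).
have xr u : 0 <= u -> x * (2 * u) `^ r = u `^ r.
  by move=> u0; rewrite powRM// mulrA /x powRN mulVf ?mul1r// gt_eqF ?powR_gt0.
(* The subtracted E * u ^ l is what absorbs the first term u ^ l when u is
   replaced by 2 * u. *)
pose D := D1 + 1 + E.
have ulr u : 0 < u <= 1 -> u ^+ l <= u `^ r.
  by move=> u01; rewrite -powR_mulrn ?ger_powR// ?ltW//; case/andP: u01.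
have Tsmall n u : 0 < u <= 1 -> T n u <= D * u `^ r - E * u ^+ l.
  elim: n u => [|n IH] u u01; have lr := ulr u u01; have [u0 u1] := andP u01.
    rewrite /T big_ord0 subr_ge0 /D.
    have : 0 <= u `^ r by exact: powR_ge0.
    by nra.
  rewrite TS; have m : Num.min 1 (u ^+ l) <= u ^+ l by rewrite ge_min lexx orbT.
  have [u2|u2] := leP (2 * u) 1.
    have := IH (2 * u); rewrite mulr_gt0// u2 => /(_ isT).
    rewrite -(ler_pM2l x0) mulrBr [x * (D * _)]mulrCA (xr u (ltW u0)) exprMn.
    rewrite [x * (E * _)]mulrCA [x * (_ * _)]mulrA mulrA EE => h.
    by apply: le_trans (lerD m h) _; lra.
  have := Tlarge n (2 * u) (ltW u2); rewrite -(ler_pM2l x0) mulrCA (xr u (ltW u0)).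
  by move=> h; apply: le_trans (lerD m h) _; rewrite /D; nra.
exists D => [|n u u0]; first by rewrite /D; lra.
rewrite -/(T n u); have [u1|u1] := leP 1 u.
  apply: le_trans (Tlarge n u u1) _; rewrite ler_wpM2r ?powR_ge0// /D; lra.
move: u0; rewrite le_eqVlt => /predU1P[<-|u0].
  rewrite powR0 ?gt_eqF// mulr0 /T big1// => i _.
  by rewrite mulr0 expr0n gtn_eqF//= min_r ?ler01 ?mulr0.
apply: le_trans (Tsmall n u _) _; first by rewrite u0 ltW.
by rewrite gerBl mulr_ge0 ?exprn_ge0 ?ltW.
Qed.

End dyadic_sums.

(** * Counting the levels *)

Section counting.

(** A level [s] stands for the dyadic boxes with sides [2 pi / 2 ^ s j]; those
    with exponents of sum [n] all have the same volume. *)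
Definition levels (d n : nat) : {set {ffun 'I_d -> 'I_n.+1}} :=
  [set s : {ffun 'I_d -> 'I_n.+1} | (\sum_j s j == n)%N].

Lemma card_levels_ge (d n : nat) : ('C(d + n, d) <= #|levels d.+1 n|)%N.
Proof.
rewrite -card_ord_partitions.
pose h (t : d.+1.-tuple 'I_n.+1) := [ffun j => tnth t j].
have hI : injective h.
  by move=> s t /ffunP st; apply: eq_from_tnth => j; have := st j; rewrite !ffunE.
rewrite -(card_imset _ hI); apply/subset_leq_card/fintype.subsetP => f.
move=> /imsetP[t]; rewrite !inE big_tuple => /eqP tn ->.
by apply/eqP; rewrite -[RHS]tn; apply: eq_bigr => j _; rewrite ffunE.
Qed.

Lemma expn_le_factM_binomial (d n : nat) : (n ^ d <= d`! * 'C(d + n, d))%N.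
Proof.
rewrite mulnC bin_ffact; elim: d => [|d IH]; first by rewrite ffactn0.
by rewrite addSn ffactSS expnS leq_mul// -addSn leq_addl.
Qed.

(** Forgetting the constraint on the sum of the entries turns the sum of
    products into a product of sums. *)
Lemma sum_levels_le {R : realType} (d n : nat) (F : 'I_d -> nat -> R) :
  (forall j i, 0 <= F j i) ->
  \sum_(s in levels d n) \prod_j F j (s j) <= \prod_j \sum_(i < n.+1) F j i.
Proof.
move=> F0; rewrite bigA_distr_bigA /= big_mkcond/=; apply: ler_sum => s _.
by case: ifP => // _; exact: prodr_ge0.
Qed.

End counting.

(** * The dyadic grid and the sample points *)

Section dyadic_grid.
Context {R : realType}.

Definition grid_center (s k : nat) : R := 2 * pi * k%:R / 2 ^+ s.

(** If both half-angle sines were below [1 / 2 ^ s], the sine of the difference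
    would be below [2 / 2 ^ s], against [sin_dyadic_ge]. *)
Lemma grid_supports_disjoint (s k k' : nat) (x : R) :
  (k < 2 ^ s)%N -> (k' < 2 ^ s)%N ->
  bump_support (2 ^+ s) (grid_center s k) x ->
  bump_support (2 ^+ s) (grid_center s k') x -> k = k'.
Proof.
wlog kk' : k k' / (k' <= k)%N => [H|ks _].
  case: (leqP k' k) => [|/ltnW] kk' ks ks' h h'; first exact: H.
  by apply/esym; exact: H.
have p0 : 0 < 2 ^+ s :> R by rewrite exprn_gt0.
rewrite /bump_support/= /wave !normrM (gtr0_norm p0) => h h'.
apply/eqP/negPn/negP => nkk'.
have dv : ~~ (2 ^ s %| k - k')%N.
  rewrite gtnNdvd ?(leq_ltn_trans (leq_subr _ _) ks)//.
  by rewrite subn_gt0 ltn_neqAle eq_sym nkk'.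
have := sin_dyadic_ge s (k - k') dv (R := R).
have -> : pi * (k - k')%:R / 2 ^+ s =
    (x - grid_center s k') / 2 - (x - grid_center s k) / 2.
  by rewrite natrB// /grid_center; field; rewrite gt_eqF.
rewrite ler_pdivrMr// => h2.
have := normr_sinB_le ((x - grid_center s k') / 2) ((x - grid_center s k) / 2).
rewrite -(ler_pM2l p0) mulrDr; move: h h' h2; rewrite mulrC; lra.
Qed.

Lemma grid_itv_sub (s k : nat) : (k < 2 ^ s)%N ->
  `[grid_center s k, grid_center s k + (2 ^+ s)^-1] `<=` `[0, 2 * pi].
Proof.
move=> ks x /=; rewrite !in_itv/= => /andP[x1 x2].
have p0 : 0 < 2 ^+ s :> R by rewrite exprn_gt0.
have c0 : 0 <= grid_center s k.
  by rewrite /grid_center !mulr_ge0 ?invr_ge0 ?pi_ge0 ?(ltW p0).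
rewrite (le_trans c0 x1)/= (le_trans x2)//.
apply: (@le_trans _ _ (2 * pi * (k%:R + 1) / 2 ^+ s)).
  rewrite /grid_center [leRHS](_ : _ =
    2 * pi * k%:R / 2 ^+ s + 2 * pi * (2 ^+ s)^-1); last by ring.
  rewrite lerD2l ler_peMl ?invr_ge0 ?(ltW p0)//.
  by have := @pi_ge2 R; lra.
rewrite ler_pdivrMr// ler_pM2l ?two_pi_gt0// natr1 -natrX ler_nat.
exact: ks.
Qed.

Definition grid (d n : nat) (s : 'I_d -> nat) : {set {ffun 'I_d -> 'I_(2 ^ n)}} :=
  [set k : {ffun 'I_d -> 'I_(2 ^ n)} | [forall j, (k j < 2 ^ s j)%N]].

Lemma card_grid (d n : nat) (s : 'I_d -> nat) : (forall j, s j <= n)%N ->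
  #|grid d n s| = (2 ^ \sum_j s j)%N.
Proof.
move=> sn; rewrite expn_sum.
transitivity #|family (fun j => [pred i : 'I_(2 ^ n) | (i < 2 ^ s j)%N])|.
  apply: eq_card => k; apply/idP/familyP => [|H]; first by rewrite inE => /forallP.
  by rewrite inE; apply/forallP.
rewrite card_family foldrE big_map big_enum; apply: eq_bigr => j _.
have sj : (2 ^ s j <= 2 ^ n)%N by rewrite leq_exp2l.
have wI : injective (widen_ord sj) by move=> i i' /(congr1 val)/= /val_inj.
rewrite -[RHS](card_ord (2 ^ s j)) -(card_imset _ wI).
apply: eq_card => i; rewrite inE; apply/idP/imsetP => [ij|[i' _ ->]].
  by exists (Ordinal ij) => //; exact: val_inj.
exact: (ltn_ord i').
Qed.

Lemma pigeonhole_rel (K : finType) (A : {set K}) (m : nat)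
    (good : K -> 'I_m -> bool) :
  (m < #|A|)%N ->
  (forall i k k', k \in A -> k' \in A -> good k i -> good k' i -> k = k') ->
  exists2 k, k \in A & forall i, ~~ good k i.
Proof.
move=> mA U; apply: contrapT => H; move: mA; apply/negP; rewrite -leqNgt.
have cov k : k \in A -> (1 <= \sum_i good k i)%N.
  move=> kA; rewrite lt0n; apply/negP => /eqP s0; apply: H; exists k => // i.
  by move/eqP: s0; rewrite sum_nat_eq0 => /forallP/(_ i)/implyP/(_ isT); case: (good k i).
rewrite -sum1_card.
apply: (@leq_trans (\sum_(k in A) \sum_i good k i)%N); first exact: leq_sum.
rewrite exchange_big/= -[leqRHS]card_ord -sum1_card; apply: leq_sum => i _.
rewrite -big_mkcondr sum1_card; apply/card_le1_eqP => k k'.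
by move=> /andP[kA gk] /andP[k'A gk']; exact: (U i).
Qed.

(** The [2 ^ n] supports of a level are disjoint, so fewer than [2 ^ n] sample
    points leave one of them free. *)
Lemma exists_free_cell (d n m : nat) (xi : 'I_m -> 'rV[R]_d) (s : 'I_d -> nat) :
  (\sum_j s j = n)%N -> (m < 2 ^ n)%N ->
  exists2 k : 'I_d -> nat, forall j, (k j < 2 ^ s j)%N &
    forall i, exists j, 1 <= `|wave (2 ^+ s j) (grid_center (s j) (k j)) (xi i 0 j)|.
Proof.
move=> sn mn.
have sj j : (s j <= n)%N by rewrite -sn (bigD1 j)//= leq_addr.
have [|i k k'|k] := @pigeonhole_rel _ (grid d n s) m
    (fun k i => [forall j,
      `|wave (2 ^+ s j) (grid_center (s j) (k j)) (xi i 0 j)| < 1]).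
- by rewrite card_grid// sn.
- rewrite !inE => /forallP ks /forallP ks' /forallP g /forallP g'.
  apply/ffunP => j; apply: val_inj.
  exact: (grid_supports_disjoint (s j) _ _ _ (ks j) (ks' j) (g j) (g' j)).
- rewrite inE => /forallP ks g; exists (fun j => nat_of_ord (k j)) => // i.
  have /forallPn[j] := g i; rewrite -leNgt => w; by exists j.
Qed.

End dyadic_grid.

(** * Sums of tensor products *)

Section tensor_sums.
Context {R : realType} (d : nat) (I : Type).
Local Notation C := R[i].
Local Open Scope complex_scope.
Local Open Scope ring_scope.
Local Notation mR := (measurableTypeR R).
Implicit Types (r : seq I) (k : R) (g : I -> 'I_d -> R -> R).

(** Real and complex versions of the same finite sum of products of functions of
    one variable: partial differences act on it factor by factor. *)
Definition tensor_sum r k g (y : 'I_d -> R) : R :=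
  k * \sum_(i <- r) \prod_j g i j (y j).

Definition tensor_fun r k g (x : 'rV[R]_d) : C :=
  (tensor_sum r k g (fun j => x 0 j))%:C.

Lemma diff1_tensor_fun r k g t j0 :
  diff1 t j0 (tensor_fun r k g) =
  tensor_fun r k (fun i j => if j == j0 then fdiff (t 0 j) (g i j) else g i j).
Proof.
apply/funext => x; rewrite /diff1 /tensor_fun /tensor_sum -rmorphB/=.
congr (_%:C); rewrite -mulrBr -sumrB; congr (_ * _); apply: eq_bigr => i _.
rewrite (bigD1 j0)//= [X in _ - X](bigD1 j0)//= [RHS](bigD1 j0)//= eqxx.
rewrite !mxE !eqxx mulr1 /fdiff mulrBl; congr (_ * _ - _ * _).
- apply: eq_bigr => j jj0; rewrite !mxE (negbTE jj0).
  by rewrite andbF mulr0 addr0.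
- by apply: eq_bigr => j /negbTE ->.
Qed.

Lemma iter_diff1_tensor_fun (l : nat) r k g t j0 :
  iter l (diff1 t j0) (tensor_fun r k g) =
  tensor_fun r k
    (fun i j => if j == j0 then iter l (fdiff (t 0 j)) (g i j) else g i j).
Proof.
elim: l => [|l IH] /=.
  by congr tensor_fun; apply/funext => i; apply/funext => j; rewrite if_same.
rewrite IH diff1_tensor_fun; congr tensor_fun.
by apply/funext => i; apply/funext => j; case: eqP.
Qed.

Lemma mixed_diff_tensor_fun (l : nat) r k g t (e : {set 'I_d}) :
  mixed_diff l t e (tensor_fun r k g) =
  tensor_fun r k
    (fun i j => if j \in e then iter l (fdiff (t 0 j)) (g i j) else g i j).
Proof.
rewrite /mixed_diff -big_filter.
have -> : (fun i j => if j \in e then iter l (fdiff (t 0 j)) (g i j) else g i j) =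
    (fun i j => if j \in [seq j <- index_enum _ | j \in e]
                then iter l (fdiff (t 0 j)) (g i j) else g i j).
  by apply/funext => i; apply/funext => j; rewrite mem_filter mem_index_enum andbT.
have : uniq [seq j <- index_enum 'I_d | j \in e].
  by rewrite filter_uniq// index_enum_uniq.
elim: [seq _ <- _ | _] => [|j0 s IH] /=; first by rewrite big_nil.
move=> /andP[j0s us]; rewrite big_cons /= (IH us) iter_diff1_tensor_fun.
congr tensor_fun; apply/funext => i; apply/funext => j; rewrite inE.
by case: eqP => // ->; rewrite (negbTE j0s).
Qed.

Lemma normc_real (a : R) : Normc.normc (a%:C : C) = `|a|.
Proof. by rewrite /Normc.normc/= expr0n addr0 sqrtr_sqr. Qed.

Lemma measurable_tensor_sum r k g : (forall i j, continuous (g i j)) ->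
  measurable_fun setT (fun u : d.-tuple mR => tensor_sum r k g (tnth u)).
Proof.
move=> cg; apply: measurable_funM => //; apply: measurable_sum => i.
apply: measurable_prod => j _.
apply: (measurableT_comp _ (measurable_tnth j)).
exact: continuous_measurable_fun.
Qed.

Lemma on_tuple_tensor_fun r k g (u : d.-tuple R) :
  on_tuple (tensor_fun r k g) u = (tensor_sum r k g (tnth u))%:C.
Proof.
rewrite /on_tuple /tensor_fun; congr (tensor_sum _ _ _ _)%:C.
by apply/funext => j; rewrite mxE.
Qed.

Lemma borel_measurable_tensor_fun r k g : (forall i j, continuous (g i j)) ->
  borel_measurable (tensor_fun r k g).
Proof.
move=> cg; split.
  rewrite (_ : on_tuple _ = fun u => tensor_sum r k g (tnth u)).
    exact: measurable_tensor_sum.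
  by apply/funext => u; have := on_tuple_tensor_fun r k g u; rewrite /on_tuple => ->.
rewrite (_ : on_tuple _ = fun u => 0); first exact: measurable_cst.
by apply/funext => u; have := on_tuple_tensor_fun r k g u; rewrite /on_tuple => ->.
Qed.

Lemma Lp_norm_tensor_fun (p : \bar R) r k g :
  Lp_norm p (tensor_fun r k g) =
  Lnorm (torus_prob d) p
    (EFin \o (fun u : d.-tuple mR => `|tensor_sum r k g (tnth u)|)).
Proof.
by apply: eq_Lnorm => u; rewrite on_tuple_tensor_fun normc_real.
Qed.

Lemma periodic_tensor_fun r k g :
  (forall i j y, g i j (y + 2 * pi) = g i j y) -> Defs.periodic (tensor_fun r k g).
Proof.
move=> pg x j0; rewrite /tensor_fun /tensor_sum; congr (_ * _)%:C.
apply: eq_bigr => i _; apply: eq_bigr => j _; rewrite !mxE/=.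
by case: eqP => _; rewrite ?mulr1 ?pg// mulr0 addr0.
Qed.

Lemma continuous_real_complex : continuous (fun a : R => a%:C : C^o).
Proof.
move=> a; apply/cvgrPdist_le => eps; rewrite ltcE => /andP[/eqP im0 re0].
near=> b; rewrite -rmorphB/= normc_def/= expr0n addr0 sqrtr_sqr lecE/= im0 eqxx/=.
by near: b; apply: cvgr_dist_le re0; exact: cvg_id.
Unshelve. all: by end_near.
Qed.

Lemma continuous_tensor_fun r k g : (forall i j, continuous (g i j)) ->
  continuous (tensor_fun r k g : 'rV[R]_d -> C^o).
Proof.
move=> cg x.
have cp i (s : seq 'I_d) :
    {for x, continuous (fun y : 'rV[R]_d => \prod_(j <- s) g i j (y 0 j))}.
  elim: s => [|j s IH].
    rewrite (_ : (fun _ => _) = cst 1); first exact: cst_continuous.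
    by apply/funext => y; rewrite big_nil.
  rewrite (_ : (fun _ => _) =
    (fun y : 'rV[R]_d => g i j (y 0 j) * \prod_(j <- s) g i j (y 0 j))).
    apply: continuousM IH; apply: continuous_comp; last exact: cg.
    exact: coord_continuous.
  by apply/funext => y; rewrite big_cons.
have cs : {for x, continuous (fun y : 'rV[R]_d =>
    \sum_(i <- r) \prod_j g i j (y 0 j))}.
  elim: r => [|i s IH].
    rewrite (_ : (fun _ => _) = cst 0); first exact: cst_continuous.
    by apply/funext => y; rewrite big_nil.
  rewrite (_ : (fun _ => _) = (fun y : 'rV[R]_d => \prod_j g i j (y 0 j) +
    \sum_(i <- s) \prod_j g i j (y 0 j))).
    exact: continuousD (cp _ _) IH.
  by apply/funext => y; rewrite big_cons.
have cts : {for x, continuous (fun y : 'rV[R]_d =>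
    tensor_sum r k g (fun j => y 0 j))}.
  by apply: continuousM => //; exact: cst_continuous.
exact: (continuous_comp cts (continuous_real_complex _)).
Qed.


End tensor_sums.

(** * Differences of sums of bumps *)

Section bump_sums_in_class.
Context {R : realType}.
Local Notation mR := (measurableTypeR R).

Lemma continuous_iter_fdiff (l : nat) (t : R) (f : R -> R) :
  continuous f -> continuous (iter l (fdiff t) f).
Proof.
move=> cf; elim: l => [//|l IH] x.
apply: cvgB; last exact: IH.
apply: (@cvg_comp _ _ _ (fun y => y + t) (iter l (fdiff t) f)); last exact: IH.
by apply: cvgD; [exact: cvg_id|exact: cvg_cst].
Qed.

Lemma bump_indic_le (N a t : R) (l L : nat) (x : R) :
  `|bump N a L.+1 x| <= \1_(diff_support N a t l) x.
Proof.
rewrite indicE; case: (boolP (x \in _)) => [_|].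
  by rewrite ger0_norm ?bump_ge0 ?bump_le1.
rewrite notin_setE => xS; rewrite bump_eq0 ?normr0// leNgt.
apply/negP => h; apply: xS; rewrite /diff_support.
rewrite -(bigcup_mkord l.+1 (fun i => bump_support N (a - i%:R * t) : set mR)).
by exists 0%N => //=; rewrite mul0r subr0.
Qed.

(** The derivative bound is the better one for steps below the width [1 / N],
    the trivial one for longer steps. *)
Lemma fdiff_bump_le (l : nat) : exists2 K : R, 1 <= K &
  forall N a t x, 1 <= N -> `|iter l (fdiff t) (bump N a l.+1) x| <=
    K * Num.min 1 ((N * `|t|) ^+ l) * \1_(diff_support N a t l) x.
Proof.
have [M M0 bM] := bump_monomial_deriv_bounded (R := R) l l.+1 0 0 (ltnSn l).
exists (M + 2 ^+ l) => [|N a t x N1].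
  by rewrite (le_trans (_ : 1 <= 2 ^+ l))// ?exprn_ege1 ?ler1n// lerDr.
rewrite indicE; case: (boolP (x \in _)) => [_|]; last first.
  by rewrite notin_setE => xS; rewrite iter_fdiff_bump_eq0// normr0 mulr0.
have N0 : 0 <= N := le_trans ler01 N1.
have l20 : 0 <= 2 ^+ l :> R by rewrite exprn_ge0.
have h1 : `|iter l (fdiff t) (bump N a l.+1) x| <= 2 ^+ l.
  rewrite -[leRHS]mulr1; apply: iter_fdiff_le_sup => y.
  by rewrite ger0_norm ?bump_ge0 ?bump_le1.
have h2 : `|iter l (fdiff t) (bump N a l.+1) x| <= M * (N * `|t|) ^+ l.
  rewrite exprMn mulrA mulrC; apply: iter_fdiff_le.
  rewrite (_ : bump N a l.+1 = bump_monomial N a l.+1 0 0); first exact: bM.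
  by apply/funext => y; rewrite /bump_monomial !mulr1.
rewrite mulr1 mulrDl minEle; case: ifP => [_|/negbT].
  by rewrite !mulr1 (le_trans h1)// lerDr.
rewrite -ltNge => /ltW _; rewrite (le_trans h2)// lerDl mulr_ge0// exprn_ge0//.
exact: mulr_ge0.
Qed.

Lemma indic_tuple_box (d : nat) (B : 'I_d -> set mR) (u : d.-tuple mR) :
  \1_(tuple_box d B) u = \prod_j \1_(B j) (tnth u j) :> R.
Proof.
rewrite indicE; case: (boolP (u \in _)) => [|].
  rewrite inE => uB; rewrite big1// => j _.
  by rewrite indicE mem_set//; exact: uB.
rewrite notin_setE => /existsNP[j uj]; apply/esym/eqP.
by rewrite (bigD1 j)//= indicE memNset// mul0r.
Qed.

Definition level_bumps (d n l : nat) (c : {ffun 'I_d -> 'I_n.+1} -> 'I_d -> R)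
    (s : {ffun 'I_d -> 'I_n.+1}) (j : 'I_d) : R -> R :=
  bump (2 ^+ s j) (c s j) l.+1.

(** The boxes have volume of order [2 ^ (- n)], and [2 ^ (- n r)] is the product
    of the [2 ^ (- r s_j)]. Distributing it over the variables leaves a product
    of one-dimensional sums: [dyadic_min_sum_le] for the variables of [e], a
    geometric series for the others. So the number of levels, which grows with
    [n], does not enter the bound. *)
Lemma Lp_norm_mixed_diff_level_bumps_le (d : nat) (r : R) (l : nat) :
  0 < r -> r < l%:R ->
  exists2 Q : R, 0 < Q &
    forall n c (q k : R) t (e : {set 'I_d}), 1 <= q ->
    (Lp_norm q%:E
       (mixed_diff l t e (tensor_fun d _ (enum (levels d n)) k (level_bumps d n l c)))
     <= (`|k| * 2 `^ (n%:R * (r - q^-1)) * Q *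
         \prod_(j in e) `|t 0 j| `^ r)%:E)%E.
Proof.
move=> r0 rl.
have [K K1 hK] := fdiff_bump_le l.
have [D D1 hD] := dyadic_min_sum_le r l r0 rl.
pose C : R := l.+1%:R * 12.
have C1 : 1 <= C.
  by rewrite /C -natrM ler1n muln_gt0.
pose x : R := 2 `^ (- r).
have /andP[x0 x1] : 0 < x < 1 := two_powRN_itv r r0.
pose D' := (1 - x)^-1.
have D'1 : 1 <= D' by rewrite invf_ge1 ?subr_gt0// gerBl ltW.
pose Q1 := K * D * D'.
have K0 : 0 <= K by exact: le_trans K1.
have D0 : 0 <= D by exact: le_trans D1.
have KD1 : 1 <= K * D by rewrite mulr_ege1.
have Q11 : 1 <= Q1 by rewrite mulr_ege1.
exists (C ^+ d * Q1 ^+ d) => [|n c q k t e q1].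
  by rewrite mulr_gt0// exprn_gt0// (lt_le_trans ltr01).
pose F j i : R := if j \in e then K * Num.min 1 ((2 ^+ i * `|t 0 j|) ^+ l) else 1.
have F0 j i : 0 <= F j i.
  by rewrite /F; case: ifP => // _; rewrite mulr_ge0// le_min ler01/=.
pose B (s : {ffun 'I_d -> 'I_n.+1}) j : set mR :=
  diff_support (2 ^+ s j) (c s j) (t 0 j) l.
pose g (s : {ffun 'I_d -> 'I_n.+1}) j := if j \in e
  then iter l (fdiff (t 0 j)) (level_bumps d n l c s j) else level_bumps d n l c s j.
have cg s j : continuous (g s j).
  rewrite /g; case: ifP => _; last exact: continuous_bump.
  by apply: continuous_iter_fdiff; exact: continuous_bump.
have pow1 i : 1 <= 2 ^+ i :> R by rewrite exprn_ege1// ler1n.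
rewrite mixed_diff_tensor_fun Lp_norm_tensor_fun -/g.
have mB s j : measurable (B s j) by exact: measurable_diff_support.
have gB s j y : `|g s j y| <= F j (s j) * \1_(B s j) y.
  rewrite /g /F; case: ifP => _; first exact: hK.
  by rewrite mul1r; exact: bump_indic_le.
have muB s : (torus_prob d (tuple_box d (B s)) <= (\prod_j (C / 2 ^+ s j))%:E)%E.
  rewrite torus_prob_box// -prodEFin; apply: lee_prod => j; first exact: measure_ge0.
  exact: circle_prob_diff_support_le.
have q0 : 0 < q := lt_le_trans ltr01 q1.
apply: le_trans (Lnorm_sum_indic_le _ _ (enum (levels d n))
    (fun s => tuple_box d (B s)) (fun s => `|k| * \prod_j F j (s j))
    (fun s => \prod_j (C / 2 ^+ s j)) _ _ q1 _ _ _ _ _) _.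
- apply: measurableT_comp => //; exact: measurable_tensor_sum.
- by move=> s; exact: measurable_tuple_box.
- by move=> s; rewrite mulr_ge0// prodr_ge0.
- exact: muB.
- move=> u; rewrite normr_id /tensor_sum normrM.
  under [leRHS]eq_bigr do rewrite -mulrA; rewrite -mulr_sumr ler_wpM2l//.
  apply: le_trans (ler_norm_sum _ _ _) _; apply: ler_sum => s _.
  rewrite indic_tuple_box -big_split/= normr_prod; apply: ler_prod => j _.
  by rewrite normr_ge0 gB.
rewrite lee_fin big_enum/=.
apply: (@le_trans _ _ (\sum_(s in levels d n) `|k| * 2 `^ (n%:R * (r - q^-1)) *
    C ^+ d * \prod_j (F j (s j) * x ^+ s j))).
  apply: ler_sum => s; rewrite inE => /eqP sn.
  have expr_sum_levels (a : R) : \prod_j a ^+ s j = a ^+ n.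
    by rewrite -(congr1 (fun i => a ^+ i) sn) expr_sum.
  have -> : \prod_j (C / 2 ^+ s j) = C ^+ d * (2 ^+ n)^-1.
    rewrite big_split/= prodr_const card_ord prodfV; congr (_ * _^-1).
    by rewrite expr_sum_levels.
  have -> : \prod_j (F j (s j) * x ^+ s j) = \prod_j F j (s j) * x ^+ n.
    by rewrite big_split/= expr_sum_levels.
  rewrite powRM ?exprn_ge0 ?invr_ge0 ?(le_trans ler01 C1)//.
  have -> : ((2 ^+ n)^-1 : R) `^ q^-1 = 2 `^ (n%:R * (r - q^-1)) * x ^+ n.
    rewrite -!powR_mulrn// ?powR_ge0// -powRN -!powRrM -powRD.
      by congr (_ `^ _); ring.
    by rewrite pnatr_eq0 implybT.
  have Cq : (C ^+ d) `^ q^-1 <= C ^+ d.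
    by rewrite ler1_powR ?exprn_ege1// invf_le1.
  have P0 : 0 <= \prod_j F j (s j) by exact: prodr_ge0.
  have T0 : 0 <= 2 `^ (n%:R * (r - q^-1)) * x ^+ n :> R.
    by rewrite mulr_ge0 ?powR_ge0// exprn_ge0// ltW.
  rewrite [leRHS](_ : _ = `|k| * \prod_j F j (s j) *
     (C ^+ d * (2 `^ (n%:R * (r - q^-1)) * x ^+ n))); last by ring.
  by rewrite ler_wpM2l ?mulr_ge0// ler_wpM2r.
rewrite -mulr_sumr -!mulrA ler_wpM2l// ler_wpM2l ?powR_ge0//.
rewrite ler_wpM2l ?exprn_ge0 ?(le_trans ler01 C1)//.
apply: le_trans (sum_levels_le d n (fun j i => F j i * x ^+ i) _) _.
  by move=> j i; rewrite mulr_ge0// exprn_ge0// ltW.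
rewrite [X in _ * X](_ : _ = \prod_j (if j \in e then `|t 0 j| `^ r else 1)); last first.
  by rewrite big_mkcond.
rewrite -[X in Q1 ^+ X](card_ord d) -prodr_const -big_split/=.
apply: ler_prod => j _; apply/andP; split.
  by apply: sumr_ge0 => i _; rewrite mulr_ge0// exprn_ge0// ltW.
rewrite /F; case: ifP => _.
  under eq_bigr do rewrite -mulrA [Num.min _ _ * _]mulrC.
  rewrite -mulr_sumr -[X in _ <= X * _]mulrA -mulrA ler_wpM2l//.
  apply: le_trans (hD _ _ (normr_ge0 _)) _; rewrite ler_wpM2r ?powR_ge0//.
  by rewrite ler_peMr.
under eq_bigr do rewrite mul1r.
rewrite mulr1; apply: le_trans (geometric_sum_le x n.+1 _) _.
  by rewrite ltW.
by rewrite /Q1 ler_peMl// (le_trans ler01).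
Qed.

End bump_sums_in_class.

(** * Reduction to functions vanishing at the sample points *)

Section recovery_lower_bound.
Context {R : realType} (d : nat).
Local Notation C := R[i].
Local Notation Rd := 'rV[R]_d.
Local Notation mR := (measurableTypeR R).

Lemma measurable_normc (h : Rd -> C) : borel_measurable h ->
  measurable_fun setT (fun u : d.-tuple mR => Normc.normc (on_tuple h u)).
Proof.
move=> [mre mim].
have -> : (fun u : d.-tuple mR => Normc.normc (on_tuple h u)) = (fun u : d.-tuple mR =>
    (on_tuple (fun x => complex.Re (h x)) u ^+ 2 +
     on_tuple (fun x => complex.Im (h x)) u ^+ 2) `^ 2^-1).
  apply/funext => u; rewrite powR12_sqrt ?addr_ge0 ?sqr_ge0//.
  by rewrite /on_tuple /Normc.normc; case: (h _).
apply: (measurableT_comp (measurable_powR _)).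
by apply: measurable_funD; apply: measurable_funX.
Qed.

Lemma borel_measurableB (f g : Rd -> C) : borel_measurable f ->
  borel_measurable g -> borel_measurable (fun x => f x - g x).
Proof.
move=> [fr fi] [gr gi]; split.
  rewrite (_ : on_tuple _ = (fun u => on_tuple (fun x => complex.Re (f x)) u -
     on_tuple (fun x => complex.Re (g x)) u)); first exact: measurable_funB.
  by apply/funext => u; rewrite /on_tuple; case: (f _) => ? ?; case: (g _).
rewrite (_ : on_tuple _ = (fun u => on_tuple (fun x => complex.Im (f x)) u -
   on_tuple (fun x => complex.Im (g x)) u)); first exact: measurable_funB.
by apply/funext => u; rewrite /on_tuple; case: (f _) => ? ?; case: (g _).
Qed.

(** [f] and [- f] produce the same samples, hence the same reconstruction [y],
    and [2 f = (f - y) - (- f - y)]. *)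
Lemma opt_recovery_ge (W : set (Rd -> C)) (p : R) (m : nat) (a : \bar R) : 1 <= p ->
  (forall xi : 'I_m -> Rd, exists f : Rd -> C,
    [/\ W f, W (fun x => - f x), borel_measurable f,
        forall i, f (xi i) = 0 & (a <= Lp_norm p%:E f)%E]) ->
  (a <= opt_recovery W p%:E m)%E.
Proof.
move=> p1 H; apply/ereal_infP => _ [xi _ <-].
apply/ereal_infP => _ [M LM <-].
have [f [Wf WNf mf f0 af]] := H xi; apply: le_trans af _.
have p0 : 0 < p := lt_le_trans ltr01 p1.
set y := M 0.
have my : borel_measurable y by case: (LM 0).
have sf : sample xi f = 0 by apply/rowP => i; rewrite !mxE f0.
have sNf : sample xi (fun x => - f x) = 0 by apply/rowP => i; rewrite !mxE f0 oppr0.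
set S := worst_error _ _ _ _.
have mNf : borel_measurable (fun x => - f x).
  have := borel_measurableB (fun=> 0) f _ mf.
  rewrite (_ : (fun x => 0 - f x) = (fun x => - f x)).
    by apply; split; exact: measurable_cst.
  by apply/funext => x; rewrite sub0r.
have S1 : (Lp_norm p%:E (fun x => (f x - y x)%R) <= S)%E.
  by apply: ereal_sup_ubound; exists f => //; rewrite sf.
have S2 : (Lp_norm p%:E (fun x => (- f x - y x)%R) <= S)%E.
  by apply: ereal_sup_ubound; exists (fun x => - f x) => //; rewrite sNf.
have h : (2%:E * Lp_norm p%:E f <= S + S)%E.
  apply: le_trans (leeD S1 S2).
  rewrite /Lp_norm -(LnormZ_ge0 _ _ _ _ p0 _ (measurable_normc _ mf))//.
  apply: le_trans (minkowski_EFin _ (measurable_normc _ (borel_measurableB _ _ mf my))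
    (measurable_normc _ (borel_measurableB _ _ mNf my)) p1).
  apply: le_Lnorm => //.
  - by apply: measurable_funM => //; exact: measurable_normc.
  - by apply: measurable_funD; apply: measurable_normc; exact: borel_measurableB.
  have n0 (z : C) : 0 <= Normc.normc z by case: z => ? ?; exact: sqrtr_ge0.
  move=> u /=; rewrite /on_tuple; move: (f _) (y _) => z w.
  rewrite !ger0_norm ?addr_ge0 ?mulr_ge0 ?n0//.
  rewrite -(normcN (- z - w)) mulr_natl -normcMn.
  have -> : z *+ 2 = (z - w) + - (- z - w).
    by rewrite opprD !opprK addrACA addNr addr0.
  exact: le_normcD.
move: h; move: (S) => {S1 S2} []; last 2 first.
- by move=> _; rewrite leey.
- by case: (Lp_norm _ _) => [b| |]//=; rewrite gt0_muley ?lte_fin.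
move=> s; case: (Lp_norm _ _) => [b| |]//=.
- by rewrite -EFinM -EFinD !lee_fin; lra.
- by rewrite gt0_muley ?lte_fin// -EFinD.
- by rewrite leNye.
Qed.

End recovery_lower_bound.

(** * Functions of the class vanishing at the sample points *)

Section fooling_function.
Context {R : realType}.
Local Notation mR := (measurableTypeR R).

Lemma tensor_funN (d : nat) (I : Type) (r : seq I) (k : R) g :
  (fun x => - tensor_fun d I r k g x) = tensor_fun d I r (- k) g.
Proof. by apply/funext => x; rewrite /tensor_fun /tensor_sum mulNr rmorphN. Qed.

Lemma level_bumps_Hclass (d : nat) (r : R) : 0 < r ->
  exists2 Q : R, 0 < Q & forall n c (q k : R), 1 <= q ->
    `|k| * 2 `^ (n%:R * (r - q^-1)) * Q <= 1 ->
    Hclass r q%:E (tensor_fun d _ (enum (levels d n)) k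
      (level_bumps d n (Num.truncn r).+1 c)).
Proof.
move=> r0; have rl : r < (Num.truncn r).+1%:R.
  by rewrite truncnS_gt.
have [Q Q0 hQ] := Lp_norm_mixed_diff_level_bumps_le d r _ r0 rl.
exists Q => // n c q k q1 k1.
have cg s j : continuous (level_bumps d n (Num.truncn r).+1 c s j).
  exact: continuous_bump.
have bound t e : (Lp_norm q%:E (mixed_diff (Num.truncn r).+1 t e
    (tensor_fun d _ (enum (levels d n)) k
       (level_bumps d n (Num.truncn r).+1 c)))
    <= (\prod_(j in e) (`|t 0 j| `^ r))%:E)%E.
  apply: le_trans (hQ n c q k t e q1) _; rewrite lee_fin ler_piMl//.
  by apply: prodr_ge0 => j _; exact: powR_ge0.
split => //; last exact: continuous_tensor_fun.
split.
- by apply: periodic_tensor_fun => s j y; exact: bump_periodic.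
- exact: borel_measurable_tensor_fun.
have := bound 0 (@finset.set0 _); rewrite /mixed_diff !big_set0 => h.
by apply: le_lt_trans h _; rewrite ltry.
Qed.

(** All bumps are nonnegative, so they cannot cancel; each is at least
    [(3 / 4) ^ ((l + 1) d)] on a box of volume [(2 pi) ^ (- d) 2 ^ (- n)]. *)
Lemma Lp_norm_level_bumps_ge (d n l : nat) (k p : R)
    (m : {ffun 'I_d -> 'I_n.+1} -> 'I_d -> nat) :
  0 <= k -> 1 <= p -> (forall s j, (m s j < 2 ^ s j)%N) ->
  ((k * (3 / 4) ^+ (l.+1 * d) *
     (#|levels d n|%:R * ((2 * pi) ^- d * 2 ^- n)) `^ p^-1)%:E <=
   Lp_norm p%:E (tensor_fun d _ (enum (levels d n)) k
     (level_bumps d n l (fun s j => grid_center (s j) (m s j)))))%E.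
Proof.
move=> k0 p1 ms.
pose J (s : {ffun 'I_d -> 'I_n.+1}) j : set mR :=
  `[grid_center (s j) (m s j), grid_center (s j) (m s j) + (2 ^+ s j)^-1]%classic.
have mJ s j : measurable (J s j) by exact: measurable_itv.
pose b (s : {ffun 'I_d -> 'I_n.+1}) : R := \prod_j ((2 * pi)^-1 * (2 ^+ s j)^-1).
have tp0 : 0 <= (2 * pi)^-1 :> R by rewrite invr_ge0 ltW ?two_pi_gt0.
have b0 s : 0 <= b s.
  by apply: prodr_ge0 => j _; rewrite mulr_ge0// invr_ge0 exprn_ge0.
have bJ s : ((b s)%:E <= torus_prob d (tuple_box d (J s)))%E.
  rewrite torus_prob_box// /b -prodEFin; apply: lee_prod => j.
    by rewrite lee_fin mulr_ge0// invr_ge0 exprn_ge0.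
  have v0 : 0 <= (2 ^+ s j)^-1 :> R by rewrite invr_ge0 exprn_ge0.
  apply: le_trans (circle_prob_itv_ge (J s j) _ _ (mJ s j) _ (@subset_refl _ _) _).
  - by rewrite addrAC subrr add0r mulrC.
  - by rewrite lerDl.
  - exact: grid_itv_sub.
have cg s j : continuous
    (level_bumps d n l (fun s j => grid_center (s j) (m s j)) s j).
  exact: continuous_bump.
rewrite Lp_norm_tensor_fun.
have -> : #|levels d n|%:R * ((2 * pi) ^- d * 2 ^- n) =
    \sum_(s <- enum (levels d n)) b s :> R.
  rewrite big_enum/= (eq_bigr (fun=> (2 * pi) ^- d * 2 ^- n)).
    by rewrite sumr_const mulr_natl.
  move=> s; rewrite inE => /eqP sn; rewrite /b big_split/= prodr_const card_ord exprVn.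
  by rewrite prodfV -(congr1 (fun i => 2 ^+ i : R) sn) expr_sum.
apply: (Lnorm_sum_indic_ge _ _ _ (fun s => tuple_box d (J s)) b) => //.
- by apply: measurableT_comp => //; exact: measurable_tensor_sum.
- by move=> s; exact: measurable_tuple_box.
- by rewrite mulr_ge0// exprn_ge0.
move=> u; rewrite normr_id /tensor_sum ger0_norm; last first.
  rewrite mulr_ge0// sumr_ge0// => s _; apply: prodr_ge0 => j _; exact: bump_ge0.
rewrite -mulrA ler_wpM2l// mulr_sumr; apply: ler_sum => s _.
rewrite indic_tuple_box exprM -[X in _ ^+ X * _](card_ord d) -prodr_const.
rewrite -big_split/=; apply: ler_prod => j _.
have e0 : 0 <= (3 / 4) ^+ l.+1 :> R by rewrite exprn_ge0.
rewrite mulr_ge0//= indicE; case: (boolP (tnth u j \in J s j)) => [|_]; last first.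
  by rewrite mulr0; exact: bump_ge0.
rewrite inE /J/= in_itv/= => /andP[u1 u2]; rewrite mulr1.
apply: bump_center_ge; first by rewrite exprn_gt0.
by rewrite ger0_norm ?subr_ge0// lerBlDl.
Qed.

End fooling_function.

(** * The lower bound *)

Section dyadic_scale.
Context {R : realType}.

Lemma ln_le_of_ltn_exp2 (m n : nat) : (0 < m)%N -> (m < 2 ^ n)%N ->
  0 <= ln (m%:R : R) <= n%:R.
Proof.
move=> m0 mn; rewrite ln_ge0 ?ler1n//=.
apply: (@le_trans _ _ (ln (2 ^+ n : R))).
  by rewrite ler_ln ?posrE ?exprn_gt0 ?ltr0n// -natrX ler_nat ltnW.
rewrite lnXn// -[leLHS]mulr_natl ler_piMr//.
by have := @le_ln1Dx R 1 ltac:(lra); rewrite (_ : 1 + 1 = 2)//; lra.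
Qed.

(** There are 'C(d + n, d) levels in dimension [d + 1], a polynomial of degree
    [d] in [n]: this is where the power of the logarithm comes from. *)
Lemma card_levels_powR_ge (d n : nat) (p v : R) : 1 <= p ->
  0 <= v <= n%:R ->
  (d`!%:R)^-1 * v `^ (d%:R / p) <= #|levels d.+1 n|%:R `^ p^-1.
Proof.
move=> p1 /andP[v0 vn]; have p0 : 0 < p := lt_le_trans ltr01 p1.
have ip0 : 0 <= p^-1 by rewrite invr_ge0 ltW.
have ip1 : p^-1 <= 1 by rewrite invf_le1.
have f0 : 0 < d`!%:R :> R by rewrite ltr0n fact_gt0.
have f1 : (d`!%:R)^-1 <= (d`!%:R)^-1 `^ p^-1 :> R.
  by rewrite ger1_powR// invr_gt0 f0 invf_le1// ler1n fact_gt0.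
rewrite powRrM powR_mulrn//.
apply: le_trans (ler_wpM2r (powR_ge0 _ _) f1) _.
rewrite -powRM ?invr_ge0 ?exprn_ge0 ?(ltW f0)//.
apply: ge0_ler_powR; rewrite ?nnegrE ?mulr_ge0 ?invr_ge0 ?exprn_ge0 ?(ltW f0) ?(ltW p0)//.
rewrite mulrC ler_pdivrMr//.
apply: (@le_trans _ _ (n%:R ^+ d)); first by rewrite lerXn2r ?nnegrE.
rewrite -natrX -natrM ler_nat mulnC.
by apply: leq_trans (expn_le_factM_binomial d n) _; rewrite leq_mul// card_levels_ge.
Qed.

Lemma powRN_dyadic_ge (m n : nat) (b r : R) : (0 < m)%N -> (2 ^ n <= 2 * m)%N ->
  0 <= b <= r -> 2 `^ (- r) * m%:R `^ (- b) <= 2 `^ (- (n%:R * b)).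
Proof.
move=> m0 nm /andP[b0 br].
apply: (@le_trans _ _ (2 `^ (- b) * m%:R `^ (- b))).
  by rewrite ler_wpM2r ?powR_ge0// ler_powR ?ler1n// lerN2.
rewrite -powRM// -mulrN powRrM powR_mulrn// !powRN.
rewrite lef_pV2 ?posrE ?powR_gt0 ?mulr_gt0 ?exprn_gt0 ?ltr0n//.
by rewrite ge0_ler_powR ?nnegrE ?exprn_ge0 ?mulr_ge0// -natrX -natrM ler_nat.
Qed.

End dyadic_scale.

Theorem theorem1p3 (R : realType) (d : nat) (hd : (0 < d)%N) (r : R) :
  exists2 c : R, 0 < c &
    forall (q p : R), 1 <= q -> q <= p -> 1 < p -> q^-1 < r ->
    forall m : nat, (0 < m)%N ->
      ((c * (m%:R `^ (- r + q^-1 - p^-1) * ln m%:R `^ ((d%:R - 1) / p)))%:E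
         <= @opt_recovery R d (Hclass r q%:E) p%:E m)%E.
Proof.
have [r0|r0] := leP r 0.
  (* The hypotheses force r to be positive. *)
  exists 1 => // q p q1 _ _ qr; suff : 0 < q^-1 by lra.
  by rewrite invr_gt0; lra.
have [Q Q0 hQ] := level_bumps_Hclass d r r0.
case: d hd Q Q0 hQ => [//|d] _ Q Q0 hQ.
set l := (Num.truncn r).+1 in hQ.
pose h : R := (3 / 4) ^+ (l.+1 * d.+1).
have h0 : 0 < h by rewrite exprn_gt0//; lra.
pose w : R := (2 * pi) ^- d.+1.
have tp1 : 1 <= 2 * pi :> R by have := @pi_ge2 R; lra.
have w0 : 0 < w by rewrite invr_gt0 exprn_gt0// two_pi_gt0.
have w1 : w <= 1 by rewrite invf_le1 ?exprn_ege1// exprn_gt0// two_pi_gt0.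
have f0 : 0 < (d`!%:R)^-1 :> R by rewrite invr_gt0 ltr0n fact_gt0.
exists (Q^-1 * h * w * (d`!%:R)^-1 * 2 `^ (- r)).
  rewrite mulr_gt0 ?powR_gt0// !(mulr_gt0 _ f0, mulr_gt0 _ w0, mulr_gt0 _ h0)//.
  by rewrite invr_gt0.
move=> q p q1 qp p1 qr m m0.
have q0 : 0 < q := lt_le_trans ltr01 q1.
have p0 : 0 < p := lt_trans ltr01 p1.
(* The scale is the least one with more cells than sample points. *)
pose n := (trunc_log 2 m).+1.
have mn : (m < 2 ^ n)%N by exact: trunc_log_ltn.
have nm : (2 ^ n <= 2 * m)%N by rewrite expnS leq_pmul2l// trunc_logP.
(* The amplitude at which the bounds on the differences of the sum of bumps are
   those that define the class. *)
pose k := Q^-1 * 2 `^ (- (n%:R * (r - q^-1))).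
have k0 : 0 <= k by rewrite mulr_ge0 ?invr_ge0 ?ltW ?powR_ge0.
have kQ : k * 2 `^ (n%:R * (r - q^-1)) * Q <= 1.
  rewrite /k powRN -mulrA [Q^-1 * _]mulrC -!mulrA.
  rewrite [Q^-1 * _]mulrC -!mulrA divff ?gt_eqF// mulr1.
  by rewrite mulVf ?gt_eqF ?powR_gt0.
apply: opt_recovery_ge; first exact: ltW.
move=> xi.
have cell (s : {ffun 'I_d.+1 -> 'I_n.+1}) : exists a : 'I_d.+1 -> nat,
    (forall j, a j < 2 ^ s j)%N /\ (s \in levels d.+1 n ->
    forall i, exists j,
      1 <= `|wave (2 ^+ s j) (grid_center (s j) (a j)) (xi i 0 j)|).
  have [sn|_] := boolP (s \in levels d.+1 n).
    move: sn; rewrite inE => /eqP sn.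
    by have [a a1 a2] := exists_free_cell _ _ _ xi (fun j => s j) sn mn; exists a.
  by exists (fun=> 0%N); split => // j; rewrite expn_gt0.
have [a ha] := choice cell.
pose f (k : R) := tensor_fun d.+1 _ (enum (levels d.+1 n)) k
  (level_bumps d.+1 n l (fun s j => grid_center (s j) (a s j))).
exists (f k); split.
- by apply: hQ => //; rewrite ger0_norm.
- by rewrite /f tensor_funN; apply: hQ => //; rewrite normrN ger0_norm.
- by apply: borel_measurable_tensor_fun => s j; exact: continuous_bump.
- move=> i; rewrite /f /tensor_fun /tensor_sum big_seq big1 ?mulr0// => s.
  rewrite mem_enum => sl; have [j wj] := (ha s).2 sl i.
  apply/eqP; rewrite prodf_seq_eq0; apply/hasP; exists j.
    exact: mem_index_enum.
  by rewrite /= /level_bumps bump_eq0.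
apply: le_trans (Lp_norm_level_bumps_ge d.+1 n l k p a k0 (ltW p1)
  (fun s j => (ha s).1 j)).
(* What remains compares powers: the amplitude and the volume give 2 ^ n to the
   exponent -(r - 1/q + 1/p), the number of levels gives the logarithm. *)
rewrite lee_fin -/w -/h.
have pi2_ge0 : 0 <= 2 * pi :> R := le_trans ler01 tp1.
rewrite powRM ?mulr_ge0 ?invr_ge0 ?exprn_ge0//.
rewrite [(w * _) `^ _]powRM ?invr_ge0 ?exprn_ge0//.
have ww : w <= w `^ p^-1.
  by apply: ger1_powR; rewrite ?w0// invf_le1// ltW.
have lm := ln_le_of_ltn_exp2 m n m0 mn (R := R).
have cl := card_levels_powR_ge d n p _ (ltW p1) lm.
have pq : p^-1 <= q^-1 by rewrite lef_pV2 ?posrE.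
have b01 : 0 <= r - q^-1 + p^-1 <= r.
  have ip0 : 0 < p^-1 by rewrite invr_gt0.
  by apply/andP; split; lra.
have sc := powRN_dyadic_ge m n _ _ m0 nm b01.
have e1 : 2 `^ (- (n%:R * (r - q^-1 + p^-1))) =
    2 `^ (- (n%:R * (r - q^-1))) * (2 ^- n) `^ p^-1 :> R.
  rewrite -powR_mulrn// -powRN -powRrM -powRD ?pnatr_eq0 ?implybT//.
  by congr (_ `^ _); ring.
have -> : d.+1%:R - 1 = d%:R :> R by rewrite -natr1 addrK.
have -> : - r + q^-1 - p^-1 = - (r - q^-1 + p^-1) by ring.
rewrite [leRHS](_ : _ = Q^-1 * h *
   (w `^ p^-1 * (#|levels d.+1 n|%:R `^ p^-1 *
     2 `^ (- (n%:R * (r - q^-1 + p^-1)))))); last by rewrite e1 /k; ring.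
rewrite [leLHS](_ : _ = Q^-1 * h * (w * ((d`!%:R)^-1 * ln m%:R `^ (d%:R / p) *
  (2 `^ (- r) * m%:R `^ (- (r - q^-1 + p^-1)))))); last by ring.
rewrite ler_wpM2l ?mulr_ge0 ?invr_ge0 ?(ltW h0) ?(ltW Q0)//.
have g0 : 0 <= (d`!%:R)^-1 * ln m%:R `^ (d%:R / p) :> R.
  by rewrite mulr_ge0 ?powR_ge0// ltW.
have g1 : 0 <= 2 `^ (- r) * m%:R `^ (- (r - q^-1 + p^-1)) :> R.
  by rewrite mulr_ge0 ?powR_ge0.
apply: ler_pM => //; [exact: ltW|exact: mulr_ge0|].
exact: ler_pM.
Qed.
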